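(* Work in $\mathsf{ES}$. Let $\mathcal{K}\subseteq\mathcal{D}$ be a class, let $Z=\emptyset$, let $W$ be a class with at least two elements, and let $T$ be a $\mathcal{K}$-compact Hausdorff $\mathcal{K}$-topology on $W$. Let $B\subseteq W$ be $T$-open such that no element of $B$ is a subset of $W$ (i.e. a set contained in $W$), and let $\Phi:W\setminus B\to\mathrm{Exp}_{\mathcal{K}}(W,T)$ be a homeomorphism onto the $\mathcal{K}$-hyperspace of $(W,T)$, where $W\setminus B$ carries the subspace topology. Then the following conditions hold, where a class $X$ is called inner if it is not an atom and $X\subseteq W$: 1. $W$ has more than one element. 2. $T=\Phi[W\setminus B]$, every element of $T$ is an inner class, and no element of $B$ is an inner class. 3. $\{x\}\in T$ for every $x\in W$. 4. $\bigcap C$ is $\emptyset$ or an element of $T$ for every nonempty $C\subseteq T$. 5. $x\cup y\in T$ for all $x,y\in T$. 6. If $x\in T$ and $x\setminus\{y\}\in T$ for all $y\in x$, then $x$ is $\mathcal{K}$-small. 7. $\bigcup C\in T$ for every nonempty $\mathcal{K}$-small $C\subseteq T$. 8. For all $a,b\in T$, the class $\{x\in W\setminus B\mid\Phi(x)\subseteq a,\ \Phi(x)\cap b\neq\emptyset\}$ is $\emptyset$ or in $T$. Consequently the following defines an interpretation $\mathcal{I}$ of $\mathsf{ES}$: the domain consists of all inner classes and all elements of $B$; $X\in^{\mathcal{I}}Y$ iff $Y$ is an inner class and $X\in\overline{\Phi}[Y]$, where $\overline{\Phi}=\Phi\cup\mathrm{id}_B$; and $\mathbb{A}^{\mathcal{I}}=B$.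 In addition, $\mathcal{I}$ interprets the statement $\mathbb{V}\in\mathbb{V}$ and the statement that every set is $\mathcal{D}$-compact Hausdorff.
   Context: Language and class axioms. The language has a binary relation symbol $\in$ and a constant $\mathbb{A}$. $X$ is an atom if $X\in\mathbb{A}$, otherwise $X$ is a class; a class that is an element of some class is a set, any other class is proper. Capital variables range over all objects, lowercase variables only over sets and atoms (objects that are elements of some class). For a formula $\phi$, $\phi^C$ is $\phi$ with all quantifiers restricted to sets and atoms. The class axioms are: Extensionality (classes $X,Y\notin\mathbb{A}$ with the same elements are equal); Atoms ($X\in\mathbb{A}\Rightarrow Y\notin X$); Nontriviality ($\exists x,y\; x\neq y$); weak Comprehension (for every formula $\psi$ of the form $\phi^C$ and all parameters $\vec P$, the class $\{x\mid\psi(x,\vec P)\}$ exists). $\mathbb{V}=\{x\mid x=x\}$; $\mathbb{T}=\{x\mid\exists y\; y\in x\}$ is the class of nonempty sets. A class $A$ is $\mathbb{T}$-closed if $A=\emptyset$ or $A\in\mathbb{T}$. $\square A=\{b\in\mathbb{T}\mid b\subseteq A\}$, $\lozenge A=\{b\in\mathbb{T}\mid b\cap A\neq\emptyset\}$. A set $d$ is discrete if all its nonempty subclasses are sets (equivalently, $d\setminus\{x\}$ is $\mathbb{T}$-closed for all $x\in d$); $\mathcal{D}$ is the class of all discrete sets. For a class $\mathcal{K}$, a class $A$ is $\mathcal{K}$-small if $A=\emptyset$ or there is a surjection from a member of $\mathcal{K}$ onto $A$. Ordered pairs are Kuratowski pairs; functions are classes of ordered pairs. $\mathsf{ES}$ (essential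 set theory) consists of the class axioms and: (2nd topology axiom) if $A\subseteq\mathbb{T}$ is nonempty, $\bigcap A$ is $\mathbb{T}$-closed; (3rd topology axiom) if $a,b$ are $\mathbb{T}$-closed, so is $a\cup b$; ($T_1$) $\{a\}$ is $\mathbb{T}$-closed; (Exponential) $\square a\cap\lozenge b$ is $\mathbb{T}$-closed for all sets $a,b$; (Discrete Additivity) $\bigcup A$ is $\mathbb{T}$-closed for every $\mathcal{D}$-small class $A$. Topology. For a class $T$, a class $A$ is $T$-closed if $A=\emptyset$ or $A\in T$. A topology on a class $X$ is a class $T$ of nonempty subsets of $X$ (its nonempty closed sets) such that $X$ is $T$-closed, $\bigcap B$ is $T$-closed for every nonempty $B\subseteq T$, and $a\cup b$ is $T$-closed for all $T$-closed $a,b$. Open classes are complements in $X$ of closed ones; Hausdorff, subspace, continuity, homeomorphism are as usual. $T$ is a $\mathcal{K}$-topology if all unions of $\mathcal{K}$-small subclasses of $T$ are $T$-closed. $T$ is $\mathcal{K}$-compact if every $B\subseteq T$ with $\bigcap B=\emptyset$ has a $\mathcal{K}$-small subclass with empty intersection. A topology is $\mathcal{K}$-generated by a class $B$ of subsets of $X$ if it is a $\mathcal{K}$-topology containing $B$ and is contained in every $\mathcal{K}$-topology on $X$ containing $B$. If $T$ is a topology on $X$ and for all $a,b\in T$ the classes $\{c\in T\mid c\subseteq a\}\cap\{c\in T\mid c\cap b\neq\emptyset\}$ are sets (or empty), the $\mathcal{K}$-hyperspace $\mathrm{Exp}_{\mathcal{K}}(X,T)$ is the set $T$ with the topology $\mathcal{K}$-generated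 by these sets. A set $a$ carries its natural topology, whose closed classes are $\emptyset$ and the nonempty subsets of $a$; topological properties of a set refer to it. ''Interpretation of $\mathsf{ES}$'' means: for every axiom $\varphi$ of $\mathsf{ES}$, the translation $\varphi^{\mathcal{I}}$ (quantifiers restricted to the domain of $\mathcal{I}$, $\in$ and $\mathbb{A}$ replaced by $\in^{\mathcal{I}}$ and $\mathbb{A}^{\mathcal{I}}$) holds; ''$\mathcal{I}$ interprets $\varphi$'' means $\varphi^{\mathcal{I}}$ holds. *)

(* Defs.v *)
Set Implicit Arguments.
Unset Strict Implicit.

(** A theorem of a first-order class theory is stated as a property of all
    structures for its language that satisfy the axioms. *)
Record structure : Type := Structure {
  obj :> Type;
  mem : obj -> obj -> Prop;
  atoms : obj
}.

Declare Scope es_scope.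
Delimit Scope es_scope with es.
Open Scope es_scope.

Notation "x ∈ y" := (mem x y) (at level 70, no associativity) : es_scope.
Notation "x ∉ y" := (~ mem x y) (at level 70, no associativity) : es_scope.
Arguments atoms : clear implicits.

(** A class term [{x | P x}], which need not denote an object.  Quantifiers over
    classes below always range over objects; class terms only stand for
    definable collections such as intersections, unions and images.  Every class
    term that is used holds of sets and atoms only. *)
Definition vclass (M : structure) : Type := M -> Prop.

Definition ext (M : structure) (X : M) : vclass M := fun x => x ∈ X.
Coercion ext : obj >-> vclass.

Definition is_class (M : structure) (X : M) : Prop := X ∉ atoms M.

(** Being a set or an atom: the range of the lowercase variables. *)
Definition element (M : structure) (x : M) : Prop := exists Y : M, x ∈ Y.

Definition is_set (M : structure) (x : M) : Prop := is_class x /\ element x.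

Definition denotes (M : structure) (P : vclass M) (C : M) : Prop :=
  is_class C /\ forall x, x ∈ C <-> P x.

Definition is_empty (M : structure) (P : vclass M) : Prop := forall x, ~ P x.
Definition nonempty (M : structure) (P : vclass M) : Prop := exists x, P x.
Definition sub (M : structure) (P Q : vclass M) : Prop := forall x, P x -> Q x.

Definition cup (M : structure) (P Q : vclass M) : vclass M := fun x => P x \/ Q x.
Definition cap (M : structure) (P Q : vclass M) : vclass M := fun x => P x /\ Q x.
Definition minus (M : structure) (P Q : vclass M) : vclass M := fun x => P x /\ ~ Q x.
Definition sing (M : structure) (a : M) : vclass M := fun x => x = a.

(** [element x] matters only for empty [A], where the intersection is the
    universe. *)
Definition bigcap (M : structure) (A : vclass M) : vclass M :=
  fun x => element x /\ forall b, A b -> x ∈ b.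
Definition bigcup (M : structure) (A : vclass M) : vclass M :=
  fun x => exists b, A b /\ x ∈ b.

(** The class term [P] denotes an element of [T]. *)
Definition is_in (M : structure) (P T : vclass M) : Prop :=
  exists C : M, denotes P C /\ T C.

Definition closed (M : structure) (T P : vclass M) : Prop :=
  is_empty P \/ is_in P T.

Definition TT (M : structure) : vclass M := fun x => element x /\ nonempty x.
Arguments TT : clear implicits.

Definition box (M : structure) (a : vclass M) : vclass M :=
  fun b => TT M b /\ sub b a.
Definition diamond (M : structure) (a : vclass M) : vclass M :=
  fun b => TT M b /\ nonempty (cap b a).

Definition discrete (M : structure) (d : M) : Prop :=
  is_set d /\
  forall X : M, is_class X -> sub X d -> nonempty X -> is_set X.

Definition upair (M : structure) (x y z : M) : Prop :=
  denotes (cup (sing x) (sing y)) z.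

Definition opair (M : structure) (x y p : M) : Prop :=
  exists s t : M, upair x x s /\ upair x y t /\ upair s t p.

Definition app (M : structure) (F x y : M) : Prop :=
  exists p : M, opair x y p /\ p ∈ F.

Definition is_function (M : structure) (F : M) (X Y : vclass M) : Prop :=
  is_class F /\
  (forall p, p ∈ F -> exists x y, X x /\ Y y /\ opair x y p) /\
  (forall x, X x -> exists! y, app F x y).

Definition surjection (M : structure) (F : M) (X Y : vclass M) : Prop :=
  is_function F X Y /\ forall y, Y y -> exists x, app F x y.

Definition bijection (M : structure) (F : M) (X Y : vclass M) : Prop :=
  surjection F X Y /\
  forall x x' y, app F x y -> app F x' y -> x = x'.

Definition image (M : structure) (F : M) (A : vclass M) : vclass M :=
  fun y => exists x, A x /\ app F x y.

Definition small (M : structure) (K : vclass M) (A : M) : Prop :=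
  is_empty A \/ exists d F : M, K d /\ surjection F d A.

(** De Bruijn indices; the other connectives are classically definable. *)
Inductive term : Type := t_var (n : nat) | t_atoms.

Inductive formula : Type :=
| f_mem (s t : term)
| f_eq (s t : term)
| f_false
| f_imp (f g : formula)
| f_all (f : formula).

Definition scons (A : Type) (a : A) (e : nat -> A) (n : nat) : A :=
  match n with O => a | S n' => e n' end.

Definition teval (M : structure) (e : nat -> M) (t : term) : M :=
  match t with t_var n => e n | t_atoms => atoms M end.

(** Truth of [f^C]: quantifiers range over sets and atoms only, while the free
    variables may be assigned arbitrary objects. *)
Fixpoint satC (M : structure) (e : nat -> M) (f : formula) : Prop :=
  match f with
  | f_mem s t => teval e s ∈ teval e t
  | f_eq s t => teval e s = teval e t
  | f_false => False
  | f_imp f g => satC e f -> satC e g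
  | f_all f => forall x : M, element x -> satC (scons x e) f
  end.

Record ES (M : structure) : Prop := {
  es_extensionality : forall X Y : M, is_class X -> is_class Y ->
    (forall x, x ∈ X <-> x ∈ Y) -> X = Y;
  es_atoms : forall X Y : M, X ∈ atoms M -> Y ∉ X;
  es_nontriviality : exists x y : M, element x /\ element y /\ x <> y;
  es_comprehension : forall (f : formula) (e : nat -> M),
    exists C : M, denotes (fun x => element x /\ satC (scons x e) f) C;
  es_top2 : forall A : M, is_class A -> sub A (TT M) -> nonempty A ->
    closed (TT M) (bigcap A);
  es_top3 : forall a b : M, is_class a -> is_class b ->
    closed (TT M) a -> closed (TT M) b -> closed (TT M) (cup a b);
  es_T1 : forall a : M, element a -> closed (TT M) (sing a);
  es_exponential : forall a b : M, is_set a -> is_set b ->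
    closed (TT M) (cap (box a) (diamond b));
  es_discrete_additivity : forall A : M, is_class A -> small (@discrete M) A ->
    closed (TT M) (bigcup A)
}.

Record topology (M : structure) (X T : vclass M) : Prop := {
  top_sub : forall t, T t -> nonempty t /\ sub t X;
  top_whole : closed T X;
  top_cap : forall B : M, is_class B -> sub B T -> nonempty B -> closed T (bigcap B);
  top_cup : forall a b : M, is_class a -> is_class b ->
    closed T a -> closed T b -> closed T (cup a b)
}.

Definition ktopology (M : structure) (K X T : vclass M) : Prop :=
  topology X T /\
  forall C : M, is_class C -> sub C T -> small K C -> closed T (bigcup C).

Definition kcompact (M : structure) (K T : vclass M) : Prop :=
  forall B : M, is_class B -> sub B T -> is_empty (bigcap B) ->
  exists C : M, is_class C /\ sub C B /\ small K C /\ is_empty (bigcap C).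

Definition is_open (M : structure) (X T : vclass M) (O : M) : Prop :=
  is_class O /\ sub O X /\ closed T (minus X O).

Definition hausdorff (M : structure) (X T : vclass M) : Prop :=
  forall x y, X x -> X y -> x <> y ->
  exists O O' : M, is_open X T O /\ is_open X T O' /\
    x ∈ O /\ y ∈ O' /\ is_empty (cap O O').

(** The closed classes of the subspace [Y].  They are a predicate on class terms
    because a trace on [Y] may be a proper class when [Y] is not closed. *)
Definition subspace_closed (M : structure) (T Y P : vclass M) : Prop :=
  exists A : M, is_class A /\ closed T A /\ forall x, P x <-> cap A Y x.

(** Spaces are given by their points and their closed classes; [R] is the graph
    of a map from [X] to [Y]. *)
Definition continuous (M : structure) (R : M -> M -> Prop)
    (X : vclass M) (clX : vclass M -> Prop)
    (Y : vclass M) (clY : vclass M -> Prop) : Prop :=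
  forall A : M, is_class A -> sub A Y -> clY A ->
  clX (fun x => X x /\ exists y, R x y /\ y ∈ A).

Definition homeomorphism (M : structure) (F : M)
    (X : vclass M) (clX : vclass M -> Prop)
    (Y : vclass M) (clY : vclass M -> Prop) : Prop :=
  bijection F X Y /\
  continuous (fun x y => app F x y) X clX Y clY /\
  continuous (fun y x => app F x y) Y clY X clX.

Definition generated (M : structure) (K X G : vclass M) (S : M) : Prop :=
  ktopology K X S /\ sub G S /\
  forall S' : M, is_class S' -> ktopology K X S' -> sub G S' -> sub S S'.

Definition hbox (M : structure) (T : vclass M) (a b : M) : vclass M :=
  cap (fun c => T c /\ sub c a) (fun c => T c /\ nonempty (cap c b)).

(** [S] is the topology of the [K]-hyperspace of [(X, T)], whose points are the
    elements of [T].  Elements of a topology are nonempty, so only the nonempty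
    generators are listed. *)
Definition hyperspace (M : structure) (K X T : vclass M) (S : M) : Prop :=
  is_class S /\ topology X T /\
  (forall a b, T a -> T b -> closed (TT M) (hbox T a b)) /\
  generated K T
    (fun g => nonempty g /\ exists a b, T a /\ T b /\ denotes (hbox T a b) g) S.

Definition inner (M : structure) (W X : M) : Prop := is_class X /\ sub X W.

Definition I_dom (M : structure) (W B : M) : vclass M :=
  fun X => inner W X \/ X ∈ B.

Definition Phi_bar (M : structure) (B Phi x y : M) : Prop :=
  app Phi x y \/ (x ∈ B /\ y = x).

Definition I_mem (M : structure) (W B Phi X Y : M) : Prop :=
  inner W Y /\ exists y, y ∈ Y /\ Phi_bar B Phi y X.

Definition interpretation (M : structure) (W B Phi : M) (HB : I_dom W B B)
    : structure :=
  @Structure { X : M | I_dom W B X }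
    (fun X Y => I_mem W B Phi (proj1_sig X) (proj1_sig Y))
    (exist _ B HB).

Definition universe_in_universe (M : structure) : Prop :=
  exists V : M, denotes (fun x => element x /\ x = x) V /\ V ∈ V.

(** The natural topology of [a] is [box a]. *)
Definition every_set_compact_hausdorff (M : structure) : Prop :=
  forall a : M, is_set a ->
    kcompact (@discrete M) (box a) /\ hausdorff a (box a).

(* Main.v *)
From Stdlib Require Import Classical.
Require Import Defs.

(** The map [Phi_bar], the homeomorphism [Phi] on [W] minus [B] and the identity
    on [B], sends [W] bijectively onto the elements of the interpretation [N].
    Every point [w] of [W] is thus the code of exactly one set or atom of [N]
    ([code]), and a class of [N], an inner class [Y], has as elements exactly
    what the points of [Y] code ([mem_code]).  Under this reading the sets
    of [N] are the elements of [T] ([TT_iff], [set_in_topology]), so each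
    topological axiom of [N] becomes a closure property of [T]
    ([closed_code]):

    - intersections and binary unions are the axioms of a topology, and
      singletons are closed because [T] is Hausdorff ([point_in_topology]);
    - the exponential axiom holds because the sets in question are coded by the
      preimage under [Phi] of a generator of the hyperspace, which is closed by
      continuity and since [B] is open ([coded_box_closed]);
    - discrete additivity holds because an element of [T] all of whose points
      are isolated is [K]-small: the complements of its points have empty
      intersection, and compactness leaves [K]-small many of them, which must
      then be all of them ([discrete_small]).  So discretely small classes of
      [N] are coded by [K]-small classes ([decodes_small]), and [T] is a
      [K]-topology.

    Comprehension in [N] reduces to comprehension in [M].  A formula over [N] is
    translated by letting bound variables range over the codes in [W]; a free
    variable stands for a code, or for a fixed object of [N] which may be a proper
    class ([translate]).  To avoid writing formulas by hand, definability is a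
    semantic predicate closed under the logical operations ([definable]).

    The universe of [N] is [W], which is a set of [N] since [W] is in [T].  For
    the compactness of the sets of [N], compactness of [T] provides [K]-small
    subfamilies with empty intersection, and these are discretely small in [N]:
    a [K]-small class of points, and each of its subclasses, is closed as a union
    of [K]-small many singletons, so it is empty or a discrete set of [N]
    ([small_discrete]).  The Hausdorff property restricts from [W] to its closed
    subsets ([trace_open]). *)

Set Implicit Arguments.
Unset Strict Implicit.

(** * Definable predicates and comprehension *)

Section Definability.

Context {M : structure}.

(** A slot of a formula is filled with a variable of the environment or with a
    parameter. *)
Definition value (s : nat + M) (e : nat -> M) : M :=
  match s with inl j => e j | inr a => a end.

(** The formula and its parameters are existentially bound, so that definable
    predicates combine without any bookkeeping of who uses which parameters. *)
Definition definable (P : (nat -> M) -> Prop) : Prop :=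
  exists (f : formula) (s : nat -> nat + M),
    forall e, satC (fun i => value (s i) e) f <-> P e.

Definition simple (t : (nat -> M) -> M) : Prop :=
  exists s : nat + M, forall e, t e = value s e.

Definition rename_term (r : nat -> nat) (t : term) : term :=
  match t with t_var n => t_var (r n) | t_atoms => t_atoms end.

Definition rename_up (r : nat -> nat) (n : nat) : nat :=
  match n with O => O | S m => S (r m) end.

Fixpoint rename (r : nat -> nat) (f : formula) : formula :=
  match f with
  | f_mem s t => f_mem (rename_term r s) (rename_term r t)
  | f_eq s t => f_eq (rename_term r s) (rename_term r t)
  | f_false => f_false
  | f_imp g h => f_imp (rename r g) (rename r h)
  | f_all g => f_all (rename (rename_up r) g)
  end.

Lemma satC_rename (f : formula) :
  forall (r : nat -> nat) (e e' : nat -> M), (forall i, e (r i) = e' i) ->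
  (satC e (rename r f) <-> satC e' f).
Proof.
  assert (Ht : forall r (e e' : nat -> M), (forall i, e (r i) = e' i) ->
    forall t, teval e (rename_term r t) = teval e' t).
  { intros r e e' H [n|]; simpl; auto. }
  induction f as [s t|s t| |g IHg h IHh|g IHg]; intros r e e' H; simpl.
  - rewrite !(Ht r e e' H); tauto.
  - rewrite !(Ht r e e' H); tauto.
  - tauto.
  - rewrite (IHg r e e' H), (IHh r e e' H); tauto.
  - assert (Hx : forall x : M,
      satC (scons x e) (rename (rename_up r) g) <-> satC (scons x e') g).
    { intros x; apply IHg; intros [|i]; simpl; auto. }
    split; intros Hall x Hx'; apply Hx; auto.
Qed.

Lemma satC_env (f : formula) (e e' : nat -> M) :
  (forall i, e i = e' i) -> (satC e f <-> satC e' f).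
Proof.
  intros H; transitivity (satC e (rename (fun i => i) f)).
  - symmetry; apply satC_rename; auto.
  - apply satC_rename; auto.
Qed.

Lemma definable_iff (P Q : (nat -> M) -> Prop) :
  (forall e, P e <-> Q e) -> definable P -> definable Q.
Proof.
  intros H [f [s Hf]]; exists f, s; intros e; rewrite Hf; apply H.
Qed.

Lemma simple_var (j : nat) : simple (fun e => e j).
Proof. exists (inl j); reflexivity. Qed.

Lemma simple_const (a : M) : simple (fun _ => a).
Proof. exists (inr a); reflexivity. Qed.

Lemma simple_rename (r : nat -> nat) (t : (nat -> M) -> M) :
  simple t -> simple (fun e => t (fun i => e (r i))).
Proof.
  intros [[j|a] H].
  - exists (inl (r j)); intros e; exact (H (fun i => e (r i))).
  - exists (inr a); intros e; exact (H (fun i => e (r i))).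
Qed.

Lemma definable_const (P : Prop) : definable (fun _ => P).
Proof.
  destruct (classic P) as [HP|HP].
  - exists (f_imp f_false f_false), (fun _ => inl 0); simpl; tauto.
  - exists f_false, (fun _ => inl 0); simpl; tauto.
Qed.

Lemma definable_mem (t u : (nat -> M) -> M) :
  simple t -> simple u -> definable (fun e => t e ∈ u e).
Proof.
  intros [s Hs] [s' Hs'].
  exists (f_mem (t_var 0) (t_var 1)), (fun i => match i with O => s | _ => s' end).
  intros e; simpl; rewrite Hs, Hs'; tauto.
Qed.

Lemma definable_eq (t u : (nat -> M) -> M) :
  simple t -> simple u -> definable (fun e => t e = u e).
Proof.
  intros [s Hs] [s' Hs'].
  exists (f_eq (t_var 0) (t_var 1)), (fun i => match i with O => s | _ => s' end).
  intros e; simpl; rewrite Hs, Hs'; tauto.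
Qed.

(** Two formulas are joined by moving the slots of one to the even and those of
    the other to the odd indices. *)
Fixpoint merge (A : Type) (s s' : nat -> A) (i : nat) : A :=
  match i with
  | O => s 0
  | S O => s' 0
  | S (S j) => merge (fun n => s (S n)) (fun n => s' (S n)) j
  end.

Fixpoint double (n : nat) : nat :=
  match n with O => O | S m => S (S (double m)) end.

Lemma merge_even (A : Type) (i : nat) : forall s s' : nat -> A,
  merge s s' (double i) = s i.
Proof. induction i as [|i IH]; intros s s'; simpl; auto; apply IH. Qed.

Lemma merge_odd (A : Type) (i : nat) : forall s s' : nat -> A,
  merge s s' (S (double i)) = s' i.
Proof.
  induction i as [|i IH]; intros s s'; [reflexivity|].
  change (merge (fun n => s (S n)) (fun n => s' (S n)) (S (double i)) = s' (S i)).
  rewrite IH; reflexivity.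
Qed.

Lemma definable_imp (P Q : (nat -> M) -> Prop) :
  definable P -> definable Q -> definable (fun e => P e -> Q e).
Proof.
  intros [f [s Hf]] [g [s' Hg]].
  exists (f_imp (rename double f) (rename (fun i => S (double i)) g)), (merge s s').
  intros e; simpl.
  rewrite (satC_rename f (e' := fun i => value (s i) e)), Hf,
    (satC_rename g (e' := fun i => value (s' i) e)), Hg; [tauto| |];
    intros i; rewrite ?merge_even, ?merge_odd; reflexivity.
Qed.

Lemma definable_all (Q : (nat -> M) -> M -> Prop) :
  definable (fun e => Q (fun i => e (S i)) (e 0)) ->
  definable (fun e => forall x, element x -> Q e x).
Proof.
  intros [f [s Hf]].
  (* The slots of the variable 0 become the bound variable; every other slot
     moves up by one and loses one level of its variable. *)
  exists (f_all (rename (fun i => match s i with inl O => O | _ => S i end) f)),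
    (fun i => match s i with inl (S j) => inl j | t => t end).
  intros e; simpl.
  assert (Hx : forall x : M,
    satC (scons x (fun i => value (match s i with inl (S j) => inl j | t => t end) e))
      (rename (fun i => match s i with inl O => O | _ => S i end) f) <-> Q e x).
  { intros x; rewrite (satC_rename f (e' := fun i => value (s i) (scons x e))).
    - rewrite Hf; simpl; tauto.
    - intros i; destruct (s i) as [[|j]|a] eqn:E; simpl; rewrite ?E; reflexivity. }
  split; intros H x Hel; apply Hx; auto.
Qed.

Lemma definable_env (P : (nat -> M) -> Prop) (e e' : nat -> M) :
  definable P -> (forall i, e i = e' i) -> (P e <-> P e').
Proof.
  intros [f [s Hf]] H; rewrite <- !Hf; apply satC_env.
  intros i; destruct (s i); simpl; auto.
Qed.

Lemma definable_rename (r : nat -> nat) (P : (nat -> M) -> Prop) :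
  definable P -> definable (fun e => P (fun i => e (r i))).
Proof.
  intros [f [s Hf]].
  exists f, (fun i => match s i with inl j => inl (r j) | t => t end).
  intros e; rewrite <- Hf; apply satC_env; intros i; destruct (s i); reflexivity.
Qed.

Lemma definable_not (P : (nat -> M) -> Prop) :
  definable P -> definable (fun e => ~ P e).
Proof. intros H; apply definable_imp; [exact H|apply definable_const]. Qed.

Lemma definable_and (P Q : (nat -> M) -> Prop) :
  definable P -> definable Q -> definable (fun e => P e /\ Q e).
Proof.
  intros HP HQ; apply (definable_iff (P := fun e => ~ (P e -> ~ Q e))).
  - intros e; tauto.
  - apply definable_not, definable_imp, definable_not; assumption.
Qed.

Lemma definable_or (P Q : (nat -> M) -> Prop) :
  definable P -> definable Q -> definable (fun e => P e \/ Q e).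
Proof.
  intros HP HQ; apply (definable_iff (P := fun e => ~ P e -> Q e)).
  - intros e; tauto.
  - apply definable_imp; [apply definable_not|]; assumption.
Qed.

(** Quantifiers over all objects are first-order over sets and atoms as soon as
    their guard holds of elements only. *)
Lemma definable_all_if (Q R : (nat -> M) -> M -> Prop) :
  (forall e x, Q e x -> element x) ->
  definable (fun e => Q (fun i => e (S i)) (e 0) -> R (fun i => e (S i)) (e 0)) ->
  definable (fun e => forall x, Q e x -> R e x).
Proof.
  intros Hel H.
  apply (definable_iff (P := fun e => forall x, element x -> Q e x -> R e x)).
  - intros e; split; intros HQ x; eauto.
  - apply definable_all; exact H.
Qed.

Lemma definable_ex (Q : (nat -> M) -> M -> Prop) :
  (forall e x, Q e x -> element x) ->
  definable (fun e => Q (fun i => e (S i)) (e 0)) ->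
  definable (fun e => exists x, Q e x).
Proof.
  intros Hel H.
  apply (definable_iff (P := fun e => ~ forall x, element x -> ~ Q e x)).
  - intros e; split.
    + intros Hn; apply NNPP; intros Hno; apply Hn; intros x _ Hx; eauto.
    + intros [x Hx] Hn; exact (Hn x (Hel _ _ Hx) Hx).
  - apply definable_not, definable_all, definable_not; exact H.
Qed.

Lemma element_mem (x X : M) : x ∈ X -> element x.
Proof. intros H; exists X; exact H. Qed.

Lemma upair_element (x y z : M) : upair x y z -> element x /\ element y.
Proof. intros [_ H]; split; exists z; apply H; red; auto; [left|right]; reflexivity. Qed.

Lemma definable_class (t : (nat -> M) -> M) :
  simple t -> definable (fun e => is_class (t e)).
Proof.
  intros H; apply definable_not, definable_mem; [exact H|apply simple_const].
Qed.

End Definability.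

(** The next two tactics read off definability from the shape of a predicate;
    guards that are not memberships leave the goal that they hold of elements
    only. *)
Ltac simple_term :=
  cbv beta;
  lazymatch goal with
  | |- simple (fun e => e _) => apply simple_var
  | |- simple _ =>
      first [assumption | apply simple_const | apply simple_rename; simple_term]
  end.

Create HintDb definable.
#[export] Hint Extern 0 (simple _) => simple_term : definable.

Ltac definable :=
  cbv beta;
  lazymatch goal with
  | |- simple _ => simple_term
  | |- definable ?P =>
      first
      [ assumption
      | apply definable_const
      | lazymatch P with
        | fun e => @?A e /\ @?B e => apply definable_and; definable
        | fun e => @?A e \/ @?B e => apply definable_or; definable
        | fun e => ~ @?A e => apply definable_not; definable
        | fun e => is_class _ => apply definable_class; definable
        | fun e => mem _ _ => apply definable_mem; definable
        | fun e => _ = _ => apply definable_eq; definable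
        | fun e => exists x, @?A e x =>
            apply (definable_ex (Q := A));
            [ cbv beta; intros; repeat match goal with H : _ /\ _ |- _ => destruct H end;
              eauto using element_mem
            | definable ]
        | fun e => @?A e -> @?B e => apply definable_imp; definable
        | fun e => forall x, @?A e x -> @?B e x =>
            apply (definable_all_if (Q := A) (R := B));
            [ cbv beta; intros; repeat match goal with H : _ /\ _ |- _ => destruct H end;
              eauto using element_mem
            | definable ]
        | _ => solve [auto with definable]
        end
      | idtac ]
  | _ => idtac
  end.

Section DefinablePairs.

Context {M : structure}.

Lemma definable_upair (t u v : (nat -> M) -> M) :
  simple t -> simple u -> simple v ->
  definable (fun e => upair (t e) (u e) (v e)).
Proof.
  intros Ht Hu Hv.
  (* The equivalence in [upair] is unguarded; one half of it is guarded by
     membership and the other half is two memberships. *)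
  apply (definable_iff (P := fun e => is_class (v e) /\ t e ∈ v e /\ u e ∈ v e /\
    forall x, x ∈ v e -> x = t e \/ x = u e)).
  - intros e; unfold upair, denotes, cup, sing; split.
    + intros [Hc [H1 [H2 H3]]]; split; [exact Hc|]; intros x; split; [auto|].
      intros [->| ->]; assumption.
    + intros [Hc H]; repeat split; [exact Hc| | |]; intros; apply H; auto.
  - definable.
Qed.
Hint Resolve definable_upair : definable.

Lemma opair_elements (x y p : M) : opair x y p -> element x /\ element y.
Proof. intros [s [t [_ [H _]]]]; exact (upair_element H). Qed.

Lemma app_elements (F x y : M) : app F x y -> element x /\ element y.
Proof. intros [p [H _]]; exact (opair_elements H). Qed.

Lemma definable_opair (t u v : (nat -> M) -> M) :
  simple t -> simple u -> simple v ->
  definable (fun e => opair (t e) (u e) (v e)).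
Proof.
  intros Ht Hu Hv; unfold opair; definable.
  - destruct H as [y [H1 [H2 H3]]]; apply upair_element in H3; tauto.
  - apply upair_element in H1; tauto.
Qed.
Hint Resolve definable_opair : definable.

Lemma definable_app (t u v : (nat -> M) -> M) :
  simple t -> simple u -> simple v ->
  definable (fun e => app (t e) (u e) (v e)).
Proof.
  intros Ht Hu Hv; unfold app; definable.
Qed.

Lemma opair_inj (x y x' y' p : M) :
  opair x y p -> opair x' y' p -> x = x' /\ y = y'.
Proof.
  intros [s [t [[_ Hs] [[_ Ht] [_ Hp]]]]] [s' [t' [[_ Hs'] [[_ Ht'] [_ Hp']]]]].
  unfold cup, sing in *.
  assert (Ex : x = x').
  { destruct (proj1 (Hp s') (proj2 (Hp' s') (or_introl eq_refl))) as [E|E]; subst s'.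
    - specialize (proj2 (Hs' x') (or_introl eq_refl)); rewrite Hs; intuition congruence.
    - specialize (proj2 (Ht x) (or_introl eq_refl)); rewrite Hs'; intuition congruence. }
  subst x'; split; [reflexivity|].
  assert (Hy' : y' = x \/ y' = y).
  { destruct (proj1 (Hp t') (proj2 (Hp' t') (or_intror eq_refl))) as [E|E]; subst t'.
    - specialize (proj2 (Ht' y') (or_intror eq_refl)); rewrite Hs; tauto.
    - specialize (proj2 (Ht' y') (or_intror eq_refl)); rewrite Ht; tauto. }
  assert (Hy : y = x \/ y = y').
  { destruct (proj1 (Hp' t) (proj2 (Hp t) (or_intror eq_refl))) as [E|E]; subst t.
    - specialize (proj2 (Ht y) (or_intror eq_refl)); rewrite Hs'; tauto.
    - specialize (proj2 (Ht y) (or_intror eq_refl)); rewrite Ht'; tauto. }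
  intuition congruence.
Qed.

Lemma function_value (F : M) (X Y : vclass M) (x y : M) :
  is_function F X Y -> app F x y -> X x /\ Y y.
Proof.
  intros [_ [H _]] [p [Hp HpF]]; destruct (H p HpF) as [x' [y' [Hx [Hy Hp']]]].
  destruct (opair_inj Hp Hp'); subst; auto.
Qed.

Context (HES : ES M).

Lemma comprehension (Q : M -> Prop) :
  (forall x, Q x -> element x) -> definable (fun e => Q (e 0)) ->
  exists C : M, denotes Q C.
Proof.
  intros Hel [f [s Hf]].
  (* [Q] looks at [e 0] only, so all variables may be identified with it. *)
  destruct (es_comprehension HES
    (rename (fun i => match s i with inl _ => O | _ => S i end) f)
    (fun i => value (s i) (fun _ => atoms M))) as [C [HC H]].
  exists C; split; [exact HC|]; intros x; rewrite H.
  rewrite (satC_rename f (e' := fun i => value (s i) (fun _ => x))).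
  - rewrite Hf; split; [tauto|]; intros HQ; auto.
  - intros i; destruct (s i) as [j|a] eqn:E; simpl; rewrite ?E; reflexivity.
Qed.

Lemma member_class (x X : M) : x ∈ X -> is_class X.
Proof. intros H HX; exact (es_atoms HES HX H). Qed.

Lemma denotes_ext (P : vclass M) (X Y : M) :
  denotes P X -> denotes P Y -> X = Y.
Proof.
  intros [HX H] [HY H']; apply (es_extensionality HES); auto.
  intros x; rewrite H, H'; tauto.
Qed.

Lemma closed_TT_denotes (P : vclass M) :
  nonempty P -> closed (TT M) P -> exists z, denotes P z /\ element z.
Proof.
  intros [x Hx] [He|[z [Hz [Hel _]]]]; [destruct (He x Hx)|eauto].
Qed.

Lemma singleton_exists (x : M) : element x ->
  exists z, denotes (sing x) z /\ element z.
Proof.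
  intros Hx; apply closed_TT_denotes; [exists x; reflexivity|].
  apply (es_T1 HES Hx).
Qed.

Lemma in_TT_closed (P : vclass M) (z : M) :
  denotes P z -> element z -> nonempty P -> closed (TT M) z.
Proof.
  intros [Hc Hz] Hel [x Hx]; right; exists z; split.
  - split; [exact Hc|]; intros y; reflexivity.
  - split; [exact Hel|]; exists x; apply Hz, Hx.
Qed.

Lemma upair_exists (x y : M) : element x -> element y ->
  exists z, upair x y z /\ element z.
Proof.
  intros Hx Hy.
  destruct (singleton_exists Hx) as [a [Ha Hael]].
  destruct (singleton_exists Hy) as [b [Hb Hbel]].
  assert (Hcl : closed (TT M) (cup a b)).
  { apply (es_top3 HES); [apply Ha|apply Hb| |].
    - apply (in_TT_closed Ha Hael); exists x; reflexivity.
    - apply (in_TT_closed Hb Hbel); exists y; reflexivity. }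
  destruct (closed_TT_denotes (P := cup a b)) as [z [[Hzc Hz] Hzel]].
  - exists x; left; apply Ha; reflexivity.
  - exact Hcl.
  - exists z; split; [|exact Hzel]; split; [exact Hzc|].
    intros w; rewrite Hz; unfold cup, ext.
    rewrite (proj2 Ha w), (proj2 Hb w); tauto.
Qed.

Lemma opair_exists (x y : M) : element x -> element y ->
  exists p, opair x y p /\ element p.
Proof.
  intros Hx Hy.
  destruct (upair_exists Hx Hx) as [s [Hs Hsel]].
  destruct (upair_exists Hx Hy) as [t [Ht Htel]].
  destruct (upair_exists Hsel Htel) as [p [Hp Hpel]].
  exists p; split; [|exact Hpel]; exists s, t; auto.
Qed.

Lemma opair_is_element (x y p : M) : opair x y p -> element p.
Proof.
  intros H; destruct (opair_elements H) as [Hx Hy].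
  destruct H as [s [t [Hs [Ht Hp]]]].
  destruct (upair_element Hp) as [Hsel Htel].
  destruct (upair_exists Hsel Htel) as [p' [Hp' Hel]].
  rewrite (denotes_ext Hp Hp'); exact Hel.
Qed.

End DefinablePairs.

#[export] Hint Resolve definable_upair definable_opair definable_app : definable.

(** * Small classes *)

Section Small.

Context {M : structure} (HES : ES M).

Definition definable2 (R : M -> M -> Prop) : Prop :=
  definable (fun e => R (e 0) (e 1)).

Lemma definable2_at (R : M -> M -> Prop) (a b : nat) :
  definable2 R -> definable (fun e => R (e a) (e b)).
Proof.
  intros H.
  exact (definable_rename (fun i => match i with O => a | _ => b end) H).
Qed.

Hint Resolve definable2_at : definable.

(** Smallness asks for a total surjection; a definable partial one suffices,
    since the points of [d] without a value can be sent to a fixed [c0] in [C]. *)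
Lemma small_of_relation (K : vclass M) (d C : M) (R : M -> M -> Prop) :
  definable2 R -> K d -> is_class C ->
  (forall c, c ∈ C -> exists u, u ∈ d /\ R u c) ->
  (forall u c c', u ∈ d -> c ∈ C -> c' ∈ C -> R u c -> R u c' -> c = c') ->
  small K C.
Proof.
  intros HR HK HC Hcov Hfun.
  destruct (classic (exists c0, c0 ∈ C)) as [[c0 Hc0]|Hno].
  2: { left; intros c Hc; apply Hno; eauto. }
  right.
  pose (G := fun u c => R u c \/ ((forall c', c' ∈ C -> ~ R u c') /\ c = c0)).
  destruct (comprehension HES (Q := fun p => exists u, u ∈ d /\
    exists c, c ∈ C /\ opair u c p /\ G u c)) as [F [HF HFp]].
  { intros p [u [_ [c [_ [H _]]]]].
    exact (opair_is_element HES H). }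
  { unfold G; definable. }
  assert (Happ : forall u c, app F u c <-> u ∈ d /\ c ∈ C /\ G u c).
  { intros u c; split.
    - intros [p [Hp HpF]]; apply HFp in HpF.
      destruct HpF as [u' [Hu' [c' [Hc' [Hp' HG]]]]].
      destruct (opair_inj Hp Hp'); subst; auto.
    - intros [Hu [Hc HG]].
      destruct (opair_exists HES (element_mem Hu) (element_mem Hc)) as [p [Hp _]].
      exists p; split; [exact Hp|]; apply HFp; exists u; split; [exact Hu|]; eauto. }
  exists d, F; split; [exact HK|]; split; [split; [exact HF|split]|].
  - intros p Hp; apply HFp in Hp.
    destruct Hp as [u [Hu [c [Hc [Hp _]]]]]; exists u, c; auto.
  - intros u Hu.
    destruct (classic (exists c, c ∈ C /\ R u c)) as [[c [Hc HRc]]|Hnone].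
    + exists c; split.
      * apply Happ; unfold G; auto.
      * intros c' Hc'; apply Happ in Hc'; destruct Hc' as [_ [Hc' [HR'|[Hn _]]]].
        -- eapply Hfun; eauto.
        -- destruct (Hn c Hc HRc).
    + exists c0; split.
      * apply Happ; repeat split; auto; right; split; eauto.
      * intros c' Hc'; apply Happ in Hc'; destruct Hc' as [_ [Hc' [HR'|[_ E]]]].
        -- destruct Hnone; eauto.
        -- auto.
  - intros c Hc; destruct (Hcov c Hc) as [u [Hu HRu]].
    exists u; apply Happ; unfold G; auto.
Qed.

Lemma small_member (K : vclass M) (d : M) : K d -> is_class d -> small K d.
Proof.
  intros HK Hd; apply (small_of_relation (d := d) (R := fun u c => u = c)); auto.
  - unfold definable2; definable.
  - eauto.
  - intros u c c' _ _ _ -> ->; reflexivity.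
Qed.

Lemma small_image (K : vclass M) (D C : M) (R : M -> M -> Prop) :
  definable2 R -> small K D -> is_class C ->
  (forall c, c ∈ C -> exists u, u ∈ D /\ R u c) ->
  (forall u c c', u ∈ D -> c ∈ C -> c' ∈ C -> R u c -> R u c' -> c = c') ->
  small K C.
Proof.
  intros HR [Hemp|[d [G [HK [HG HGs]]]]] HC Hcov Hfun.
  { left; intros c Hc; destruct (Hcov c Hc) as [u [Hu _]]; exact (Hemp u Hu). }
  assert (Hval : forall x u, app G x u -> x ∈ d /\ u ∈ D).
  { intros x u; exact (function_value HG). }
  destruct HG as [_ [_ HGf]].
  apply (small_of_relation (d := d)
    (R := fun x c => exists u, u ∈ D /\ app G x u /\ R u c)); auto.
  - unfold definable2; definable.
  - intros c Hc; destruct (Hcov c Hc) as [u [Hu Huc]].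
    destruct (HGs u Hu) as [x Hx]; exists x; split; [apply (Hval x u Hx)|eauto].
  - intros x c c' Hx Hc Hc' [u [Hu [Hxu Huc]]] [u' [Hu' [Hxu' Huc']]].
    destruct (HGf x Hx) as [v [_ Hv]].
    assert (u = u') by (rewrite <- (Hv u Hxu); auto); subst u'.
    exact (Hfun u c c' Hu Hc Hc' Huc Huc').
Qed.

Lemma small_subclass (K : vclass M) (D C : M) :
  small K D -> is_class C -> sub C D -> small K C.
Proof.
  intros HD HC Hsub; apply (small_image (D := D) (R := fun u c => u = c)); auto.
  - unfold definable2; definable.
  - intros c Hc; exists c; split; [exact (Hsub c Hc)|reflexivity].
  - intros u c c' _ _ _ -> ->; reflexivity.
Qed.

End Small.
#[export] Hint Resolve definable2_at : definable.
(** * Compact Hausdorff topologies *)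

Section CompactSpace.

Context {M : structure} (HES : ES M) {K W T : M}.

Lemma closed_iff (V P Q : vclass M) :
  (forall x, P x <-> Q x) -> closed V P -> closed V Q.
Proof.
  intros H [He|[C [[HC HP] HV]]].
  - left; intros x Hx; apply (He x), H, Hx.
  - right; exists C; split; [split; [exact HC|]|exact HV].
    intros x; rewrite HP; apply H.
Qed.

Lemma closed_is_in (V P : vclass M) : closed V P -> nonempty P -> is_in P V.
Proof. intros [He|H] [x Hx]; [destruct (He x Hx)|exact H]. Qed.

Lemma closed_member (V : vclass M) (a : M) :
  is_class a -> closed V a -> nonempty a -> V a.
Proof.
  intros Ha Hcl Hne; destruct (closed_is_in Hcl Hne) as [C [HC HV]].
  rewrite (denotes_ext HES (P := a) (X := a) (Y := C)); auto.
  split; [exact Ha|]; intros x; reflexivity.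
Qed.

Lemma member_closed (V : vclass M) (a : M) : is_class a -> V a -> closed V a.
Proof.
  intros Ha HV; right; exists a; split; [split; [exact Ha|]|exact HV].
  intros x; reflexivity.
Qed.

Context (Ttop : ktopology K W T).

Lemma topology_nonempty (t : M) : t ∈ T -> exists z, z ∈ t.
Proof. intros Ht; exact (proj1 (top_sub (proj1 Ttop) Ht)). Qed.

Lemma topology_points (t z : M) : t ∈ T -> z ∈ t -> z ∈ W.
Proof. intros Ht; exact (proj2 (top_sub (proj1 Ttop) Ht) z). Qed.

Lemma topology_class (t : M) : t ∈ T -> is_class t.
Proof.
  intros Ht; destruct (topology_nonempty Ht) as [z Hz]; exact (member_class HES Hz).
Qed.

Lemma whole_in_topology (x : M) : x ∈ W -> W ∈ T.
Proof.
  intros Hx; apply (closed_member (V := T)).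
  - exact (member_class HES Hx).
  - exact (top_whole (proj1 Ttop)).
  - exists x; exact Hx.
Qed.

Lemma closed_cap (a b : M) : is_class a -> is_class b ->
  closed T a -> closed T b -> closed T (cap a b).
Proof.
  intros Ha Hb Hca Hcb.
  destruct (classic (nonempty (cap a b))) as [[x [Hxa Hxb]]|Hno].
  2: { left; intros x Hx; apply Hno; exists x; exact Hx. }
  assert (HaT : a ∈ T) by (apply (closed_member (V := T)); auto; exists x; exact Hxa).
  assert (HbT : b ∈ T) by (apply (closed_member (V := T)); auto; exists x; exact Hxb).
  destruct (upair_exists HES (element_mem HaT) (element_mem HbT)) as [P [[HPc HP] _]].
  apply (closed_iff (P := bigcap P)).
  - intros z; split.
    + intros [_ H]; split; apply H, HP; [left|right]; reflexivity.
    + intros [Hza Hzb]; split; [exact (element_mem Hza)|].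
      intros t Ht; apply HP in Ht; destruct Ht as [->| ->]; assumption.
  - apply (top_cap (proj1 Ttop)); [exact HPc| |].
    + intros t Ht; apply HP in Ht; destruct Ht as [->| ->]; assumption.
    + exists a; apply HP; left; reflexivity.
Qed.

Context (Thaus : hausdorff W T).

(** The closed sets that contain [x] intersect in [x] alone, because disjoint
    open neighbourhoods of [x] and [z] give a closed set with [x] and without
    [z]. *)
Lemma point_in_topology (x : M) : x ∈ W -> exists s, denotes (sing x) s /\ s ∈ T.
Proof.
  intros Hx.
  destruct (comprehension HES (Q := fun t => t ∈ T /\ x ∈ t)) as [C [HC HCt]].
  { intros t [Ht _]; exact (element_mem Ht). }
  { definable. }
  assert (HWC : W ∈ C).
  { apply HCt; split; [exact (whole_in_topology Hx)|exact Hx]. }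
  assert (Hcl : closed T (bigcap C)).
  { apply (top_cap (proj1 Ttop)); [exact HC| |exists W; exact HWC].
    intros t Ht; apply HCt in Ht; apply Ht. }
  apply closed_iff with (Q := sing x) in Hcl.
  - apply closed_is_in; [exact Hcl|exists x; reflexivity].
  - intros z; unfold sing; split.
    + intros [_ Hz]; apply NNPP; intros Hne.
      destruct (Thaus (x := x) (y := z)) as [O [O' [_ [[HO' [_ Hcl']] [HxO [HzO' Hd]]]]]].
      * exact Hx.
      * exact (Hz W HWC).
      * congruence.
      * destruct (closed_is_in Hcl') as [t [[_ Ht] HtT]].
        { exists x; split; [exact Hx|]; intros HxO'; exact (Hd x (conj HxO HxO')). }
        assert (HtC : t ∈ C).
        { apply HCt; split; [exact HtT|]; apply Ht; split; [exact Hx|].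
          intros HxO'; exact (Hd x (conj HxO HxO')). }
        apply (proj2 (proj1 (Ht z) (Hz t HtC))); exact HzO'.
    + intros ->; split; [exact (element_mem Hx)|].
      intros t Ht; apply HCt in Ht; apply Ht.
Qed.

(** Such a class is the union of [K]-small many closed singletons. *)
Lemma small_closed (C : M) : is_class C -> sub C W -> small K C -> closed T C.
Proof.
  intros HC HCW Hsm.
  pose (R := fun x s : M => x ∈ s /\ forall z, z ∈ s -> z = x).
  destruct (comprehension HES (Q := fun s => s ∈ T /\ exists x, x ∈ C /\ R x s))
    as [D [HD HDs]].
  { intros s [Hs _]; exact (element_mem Hs). }
  { unfold R; definable. }
  apply (closed_iff (P := bigcup D)).
  - intros z; split.
    + intros [s [Hs Hz]]; apply HDs in Hs; destruct Hs as [_ [x [Hx [_ Hsx]]]].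
      rewrite (Hsx z Hz); exact Hx.
    + intros Hz; destruct (point_in_topology (HCW z Hz)) as [s [[_ Hs] HsT]].
      assert (Hzs : z ∈ s) by (apply Hs; reflexivity).
      exists s; split; [|exact Hzs].
      apply HDs; split; [exact HsT|]; exists z; repeat split; auto.
      intros y Hy; apply Hs, Hy.
  - apply (proj2 Ttop); [exact HD| |].
    + intros s Hs; apply HDs in Hs; apply Hs.
    + apply (small_image HES (D := C) (R := R)); auto.
      * unfold definable2, R; definable.
      * intros s Hs; apply HDs in Hs; apply Hs.
      * intros x s s' _ Hs Hs' [Hx H] [Hx' H']; apply (es_extensionality HES).
        -- exact (member_class HES Hx).
        -- exact (member_class HES Hx').
        -- intros z; split; intros Hz; [rewrite (H z Hz)|rewrite (H' z Hz)]; assumption.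
Qed.

Context (Tcomp : kcompact K T)
  (W_two : exists x y, x ∈ W /\ y ∈ W /\ x <> y).

(** If only the empty class were [K]-small, compactness would give any two
    disjoint closed sets, such as two distinct singletons, a common point. *)
Lemma nonempty_index : exists d u, d ∈ K /\ u ∈ d.
Proof.
  destruct W_two as [x [y [Hx [Hy Hne]]]].
  destruct (point_in_topology Hx) as [s [[_ Hs] HsT]].
  destruct (point_in_topology Hy) as [t [[_ Ht] HtT]].
  destruct (upair_exists HES (element_mem HsT) (element_mem HtT)) as [P [[HPc HP] _]].
  destruct (Tcomp (B := P)) as [C [HC [_ [[Hemp|[d [F [Hd [[_ [HFp _]] HFs]]]]] HCe]]]].
  - exact HPc.
  - intros z Hz; apply HP in Hz; destruct Hz as [->| ->]; assumption.
  - intros z [_ Hz].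
    assert (Hzs : z ∈ s) by (apply Hz, HP; left; reflexivity).
    assert (Hzt : z ∈ t) by (apply Hz, HP; right; reflexivity).
    apply Hs in Hzs; apply Ht in Hzt; unfold sing in *; congruence.
  - destruct (HCe x); split; [exact (element_mem Hx)|].
    intros b Hb; destruct (Hemp b Hb).
  - destruct (classic (exists c, c ∈ C)) as [[c Hc]|Hno].
    + destruct (HFs c Hc) as [u [p [_ Hp]]].
      destruct (HFp p Hp) as [v [_ [Hv _]]]; exists d, v; split; assumption.
    + destruct (HCe x); split; [exact (element_mem Hx)|].
      intros b Hb; destruct Hno; exists b; exact Hb.
Qed.

Lemma small_point (x s : M) : denotes (sing x) s -> small K s.
Proof.
  intros [Hc Hs]; destruct nonempty_index as [d [u [Hd Hu]]].
  apply (small_of_relation HES (d := d) (R := fun _ _ => True)); auto.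
  - exact (definable_const True).
  - intros c _; exists u; auto.
  - intros _ c c' _ Hc1 Hc2 _ _; apply Hs in Hc1; apply Hs in Hc2.
    unfold sing in *; congruence.
Qed.

(** Compactness applied to the complements of the points of [x] inside [x]: a
    subfamily with empty intersection must omit every point of [x], hence
    contains all these complements, and the point is definable from its
    complement.  A singleton needs a separate argument, since its only complement
    is empty and so not in [T]. *)
Lemma discrete_small (x : M) : x ∈ T ->
  (forall y, y ∈ x -> closed T (minus x (sing y))) -> small K x.
Proof.
  intros Hx Hiso.
  destruct (classic (exists y, y ∈ x /\ forall z, z ∈ x -> z = y)) as [[y [Hy Hall]]|Hmany].
  { apply (small_point (x := y)); split; [exact (topology_class Hx)|].
    intros z; unfold sing; split; [apply Hall|intros ->; exact Hy]. }
  (* [R t y]: the set [t] is [x] without its point [y]. *)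
  pose (R := fun t y => y ∈ x /\ y ∉ t /\ (forall z, z ∈ t -> z ∈ x) /\
    (forall z, z ∈ x -> z <> y -> z ∈ t)).
  assert (Hcompl : forall y, y ∈ x -> exists t, t ∈ T /\ R t y).
  { intros y Hy; destruct (closed_is_in (Hiso y Hy)) as [t [[_ Ht] HtT]].
    - apply NNPP; intros Hno; apply Hmany; exists y; split; [exact Hy|].
      intros z Hz; apply NNPP; intros Hzy; apply Hno; exists z; split; assumption.
    - exists t; split; [exact HtT|]; repeat split.
      + exact Hy.
      + intros Hyt; apply Ht in Hyt; apply (proj2 Hyt); reflexivity.
      + intros z Hz; apply Ht in Hz; apply Hz.
      + intros z Hz Hzy; apply Ht; split; assumption. }
  destruct (comprehension HES (Q := fun t => t ∈ T /\ exists y, R t y)) as [D [HD HDt]].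
  { intros t [Ht _]; exact (element_mem Ht). }
  { unfold R; definable. }
  destruct (Tcomp (B := D)) as [C [HC [HCD [HCs HCe]]]].
  - exact HD.
  - intros t Ht; apply HDt in Ht; apply Ht.
  - intros z [_ Hz].
    destruct (topology_nonempty Hx) as [y Hy].
    destruct (Hcompl y Hy) as [t [HtT HR]].
    assert (Hzx : z ∈ x).
    { assert (Hzt : z ∈ t) by (apply Hz, HDt; eauto).
      destruct HR as [_ [_ [Hsub _]]]; exact (Hsub z Hzt). }
    destruct (Hcompl z Hzx) as [t' [Ht'T HR']].
    apply (proj1 (proj2 HR')), Hz, HDt; eauto.
  - apply (small_image HES (D := C) (R := R)); auto.
    + unfold definable2, R; definable.
    + exact (topology_class Hx).
    + intros y Hy.
      assert (Hex : exists t, t ∈ C /\ y ∉ t).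
      { apply NNPP; intros Hno; apply (HCe y); split; [exact (element_mem Hy)|].
        intros t Ht; apply NNPP; intros Hyt; eauto. }
      destruct Hex as [t [Ht Hyt]]; exists t; split; [exact Ht|].
      destruct (proj1 (HDt t) (HCD t Ht)) as [_ [y' HR]].
      replace y with y'; [exact HR|].
      apply NNPP; intros Hne; apply Hyt, HR; [exact Hy|congruence].
    + intros t c c' _ Hc Hc' HR HR'; apply NNPP; intros Hne.
      apply (proj1 (proj2 HR')), HR; [exact Hc'|congruence].
Qed.

End CompactSpace.

(** * The homeomorphism with the hyperspace *)

Section Hyperspace.

Context {M : structure} (HES : ES M) {K W T B Phi S : M}.
Context (Ttop : ktopology K W T) (Bopen : is_open W T B)
  (HS : hyperspace K W T S)
  (HPhi : homeomorphism Phi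
     (minus W B) (subspace_closed T (minus W B)) T (closed S)).

Lemma homeo_value (x t : M) : app Phi x t -> x ∈ W /\ x ∉ B /\ t ∈ T.
Proof.
  intros [p [Hp HpP]].
  destruct HPhi as [[[[_ [Hpair _]] _] _] _].
  destruct (Hpair p HpP) as [x' [t' [[HW HB] [Ht Hp']]]].
  destruct (opair_inj Hp Hp'); subst; auto.
Qed.

Lemma homeo_total (x : M) : x ∈ W -> x ∉ B -> exists t, app Phi x t.
Proof.
  intros HW HB; destruct HPhi as [[[[_ [_ Hf]] _] _] _].
  destruct (Hf x (conj HW HB)) as [t [Ht _]]; exists t; exact Ht.
Qed.

Lemma homeo_functional (x t t' : M) : app Phi x t -> app Phi x t' -> t = t'.
Proof.
  intros Ht Ht'; destruct (homeo_value Ht) as [HW [HB _]].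
  destruct HPhi as [[[[_ [_ Hf]] _] _] _].
  destruct (Hf x (conj HW HB)) as [u [_ Hu]].
  rewrite <- (Hu t Ht); exact (Hu t' Ht').
Qed.

Lemma homeo_injective (x x' t : M) : app Phi x t -> app Phi x' t -> x = x'.
Proof. destruct HPhi as [[_ H] _]; apply H. Qed.

Lemma homeo_onto (t : M) : t ∈ T -> exists x, app Phi x t.
Proof. destruct HPhi as [[[_ H] _] _]; apply H. Qed.

(** The class is the preimage of a closed set of the hyperspace, so it is the
    trace of a closed set on [W] minus [B], which is itself closed as [B] is
    open. *)
Lemma coded_box_closed (a b : M) : a ∈ T -> b ∈ T ->
  closed T (fun x => minus W B x /\
    exists t, app Phi x t /\ sub t a /\ nonempty (cap t b)).
Proof.
  intros Ha Hb.
  destruct (comprehension HES (Q := fun t => t ∈ T /\ (forall z, z ∈ t -> z ∈ a) /\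
    exists z, z ∈ t /\ z ∈ b)) as [g [Hg Hgt]].
  { intros t [Ht _]; exact (element_mem Ht). }
  { definable. }
  destruct (classic (nonempty g)) as [Hne|Hno].
  2: { left; intros x [_ [t [Hxt [Hta Htb]]]]; apply Hno; exists t; apply Hgt.
       split; [apply (homeo_value Hxt)|split; assumption]. }
  destruct HS as [_ [_ [_ [_ [HGS _]]]]].
  assert (HgS : closed S g).
  { apply member_closed; [exact Hg|]; apply HGS; split; [exact Hne|].
    exists a, b; split; [exact Ha|split; [exact Hb|split; [exact Hg|]]].
    intros x; rewrite Hgt; unfold hbox, cap, sub, nonempty, ext; tauto. }
  destruct HPhi as [_ [Hcont _]].
  destruct (Hcont g Hg) as [A [HA [HclA HAx]]].
  { intros t Ht; apply Hgt in Ht; apply Ht. }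
  { exact HgS. }
  destruct (comprehension HES (Q := fun x => x ∈ W /\ x ∉ B)) as [R [HR HRx]].
  { intros x [Hx _]; exact (element_mem Hx). }
  { definable. }
  assert (HclR : closed T R).
  { apply (closed_iff (P := minus W B)).
    - intros x; symmetry; apply HRx.
    - apply Bopen. }
  apply (closed_iff (P := cap A R)).
  - intros x; split.
    + intros [HxA HxR]; apply HRx in HxR.
      destruct (proj2 (HAx x) (conj HxA HxR)) as [HxWB [t [Hxt Ht]]].
      apply Hgt in Ht; destruct Ht as [_ [Hta Htb]].
      split; [exact HxWB|]; exists t; split; [exact Hxt|split; assumption].
    + intros [HxWB [t [Hxt [Hta Htb]]]]; split.
      * apply (HAx x); split; [exact HxWB|]; exists t; split; [exact Hxt|].
        apply Hgt; split; [apply (homeo_value Hxt)|split; assumption].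
      * apply HRx; exact HxWB.
  - apply (closed_cap HES Ttop); assumption.
Qed.

End Hyperspace.
(** * Codes for the objects of the interpretation *)

Section Interpretation.

Context {M : structure} (HES : ES M) {K W T B Phi : M}.
Context (HB : I_dom W B B).

Notation N := (interpretation Phi HB).

Definition val (X : N) : M := proj1_sig X.

Definition inner_object (X : M) (HX : inner W X) : N := exist _ X (or_introl HX).

Definition code (w : M) (X : N) : Prop := w ∈ W /\ Phi_bar B Phi w (val X).

Context (Ttop : ktopology K W T) (Thaus : hausdorff W T) (Tcomp : kcompact K T)
  (W_two : exists x y, x ∈ W /\ y ∈ W /\ x <> y)
  (W_class : is_class W) (B_class : is_class B) (B_sub : sub B W)
  (B_not_inner : forall x, x ∈ B -> ~ inner W x)
  (Phi_value : forall x t, app Phi x t -> x ∈ W /\ x ∉ B /\ t ∈ T)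
  (Phi_total : forall x, x ∈ W -> x ∉ B -> exists t, app Phi x t)
  (Phi_functional : forall x t t', app Phi x t -> app Phi x t' -> t = t')
  (Phi_injective : forall x x' t, app Phi x t -> app Phi x' t -> x = x')
  (Phi_onto : forall t, t ∈ T -> exists x, app Phi x t)
  (box_closed : forall a b, a ∈ T -> b ∈ T ->
     closed T (fun x => minus W B x /\
       exists t, app Phi x t /\ sub t a /\ nonempty (cap t b))).

Lemma topology_inner (t : M) : t ∈ T -> inner W t.
Proof.
  intros Ht; split; [exact (topology_class HES Ttop Ht)|].
  intros z; exact (topology_points Ttop Ht).
Qed.

Lemma val_inj (X Y : N) : val X = val Y -> X = Y.
Proof.
  destruct X as [x Hx], Y as [y Hy]; unfold val; simpl; intros ->.
  rewrite (proof_irrelevance _ Hx Hy); reflexivity.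
Qed.

Lemma code_inner (w : M) (X : N) : code w X -> inner W (val X) -> app Phi w (val X).
Proof.
  intros [_ [H|[HwB E]]] HX; [exact H|].
  rewrite E in HX; destruct (B_not_inner HwB HX).
Qed.

Lemma code_of_app (w : M) (X : N) : app Phi w (val X) -> code w X.
Proof. intros H; split; [apply (Phi_value H)|left; exact H]. Qed.

Lemma code_total (w : M) : w ∈ W -> exists X : N, code w X.
Proof.
  intros Hw; destruct (classic (w ∈ B)) as [HwB|HwB].
  - exists (exist _ w (or_intror HwB)); split; [exact Hw|right; auto].
  - destruct (Phi_total Hw HwB) as [t Ht].
    exists (inner_object (topology_inner (proj2 (proj2 (Phi_value Ht))))).
    apply code_of_app; exact Ht.
Qed.

Lemma code_functional (w : M) (X Y : N) : code w X -> code w Y -> X = Y.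
Proof.
  intros [_ HX] [_ HY]; apply val_inj.
  destruct HX as [HX|[HwB EX]], HY as [HY|[HwB' EY]].
  - exact (Phi_functional HX HY).
  - destruct (proj1 (proj2 (Phi_value HX)) HwB').
  - destruct (proj1 (proj2 (Phi_value HY)) HwB).
  - congruence.
Qed.

Lemma code_injective (w w' : M) (X : N) : code w X -> code w' X -> w = w'.
Proof.
  intros [_ [HX|[HwB EX]]] [_ [HY|[HwB' EY]]].
  - exact (Phi_injective HX HY).
  - rewrite EY in HX; destruct (B_not_inner HwB').
    apply topology_inner, (Phi_value HX).
  - rewrite EX in HY; destruct (B_not_inner HwB).
    apply topology_inner, (Phi_value HY).
  - congruence.
Qed.

Lemma mem_iff (X Y : N) :
  X ∈ Y <-> inner W (val Y) /\ exists w, w ∈ val Y /\ code w X.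
Proof.
  split.
  - intros [HY [w [Hw HX]]]; split; [exact HY|]; exists w; split; [exact Hw|].
    split; [exact (proj2 HY w Hw)|exact HX].
  - intros [HY [w [Hw [_ HX]]]]; split; [exact HY|]; exists w; split; assumption.
Qed.

Lemma mem_code (w : M) (X Y : N) :
  code w X -> inner W (val Y) -> (X ∈ Y <-> w ∈ val Y).
Proof.
  intros HX HY; rewrite mem_iff; split.
  - intros [_ [v [Hv HvX]]]; rewrite (code_injective HX HvX); exact Hv.
  - intros Hw; split; [exact HY|]; exists w; split; assumption.
Qed.

Lemma class_iff (X : N) : is_class X <-> inner W (val X).
Proof.
  unfold is_class; split.
  - intros H; destruct X as [x [Hx|Hx]]; [exact Hx|].
    destruct H; split; [split; assumption|]; exists x; split; [exact Hx|right; auto].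
  - intros HX [_ [w [Hw HwX]]]; simpl in Hw, HwX.
    destruct HwX as [HwX|[HwB E]].
    + exact (proj1 (proj2 (Phi_value HwX)) Hw).
    + unfold val in HX; rewrite E in HX; exact (B_not_inner HwB HX).
Qed.

Lemma whole_inner : inner W W.
Proof. split; [exact W_class|]; intros x Hx; exact Hx. Qed.

Lemma element_iff (X : N) : element X <-> exists w, code w X.
Proof.
  split.
  - intros [Y HY]; apply mem_iff in HY; destruct HY as [_ [w [_ Hw]]]; eauto.
  - intros [w Hw]; exists (inner_object whole_inner).
    apply (mem_code Hw (Y := inner_object whole_inner) whole_inner), Hw.
Qed.

Lemma member_coded (X : N) (w : M) :
  inner W (val X) -> w ∈ val X -> exists Y, code w Y /\ Y ∈ X.
Proof.
  intros HX Hw; destruct (code_total (proj2 HX w Hw)) as [Y HY].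
  exists Y; split; [exact HY|apply (mem_code HY HX); exact Hw].
Qed.

Lemma nonempty_iff (X : N) : inner W (val X) -> (nonempty X <-> nonempty (val X)).
Proof.
  intros HX; split.
  - intros [Y HY]; apply mem_iff in HY; destruct HY as [_ [w [Hw _]]]; exists w; exact Hw.
  - intros [w Hw]; destruct (member_coded HX Hw) as [Y [_ HY]]; exists Y; exact HY.
Qed.

Lemma sub_iff (X Y : N) : inner W (val X) -> inner W (val Y) ->
  (sub X Y <-> sub (val X) (val Y)).
Proof.
  intros HX HY; split.
  - intros H w Hw; destruct (member_coded HX Hw) as [Z [HZ HZX]].
    apply (mem_code HZ HY), H, HZX.
  - intros H Z HZ; apply mem_iff in HZ; destruct HZ as [_ [w [Hw Hc]]].
    apply (mem_code Hc HY), H, Hw.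
Qed.

Lemma TT_iff (X : N) : TT N X <-> val X ∈ T.
Proof.
  split.
  - intros [Hel [Y HY]]; apply element_iff in Hel; destruct Hel as [w Hw].
    apply mem_iff in HY; destruct HY as [HX _].
    apply (Phi_value (code_inner Hw HX)).
  - intros HX; split.
    + apply element_iff; destruct (Phi_onto HX) as [w Hw].
      exists w; apply code_of_app; exact Hw.
    + apply nonempty_iff; [exact (topology_inner HX)|].
      exact (topology_nonempty Ttop HX).
Qed.

Lemma set_in_topology (X : N) : is_set X -> val X ∈ T.
Proof.
  intros [HX Hel]; apply class_iff in HX; apply element_iff in Hel.
  destruct Hel as [w Hw]; apply (Phi_value (code_inner Hw HX)).
Qed.

Lemma topology_set (X : N) : val X ∈ T -> is_set X.
Proof.
  intros HX; split; [apply class_iff; exact (topology_inner HX)|].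
  apply TT_iff in HX; apply HX.
Qed.

(** Transfers closedness: a class term of [N] is closed when the class of the
    codes of its members is. *)
Lemma closed_code (P : vclass N) (Q : vclass M) :
  (forall X, P X -> element X) -> sub Q W ->
  (forall w X, code w X -> (P X <-> Q w)) ->
  closed T Q -> closed (TT N) P.
Proof.
  intros Hel HQW HPQ [He|[C [[HC HCQ] HCT]]].
  - left; intros X HX; destruct (proj1 (element_iff X) (Hel X HX)) as [w Hw].
    apply (He w), (HPQ w X Hw), HX.
  - right; exists (inner_object (topology_inner HCT)); split; [split|].
    + apply class_iff; exact (topology_inner HCT).
    + intros X; split.
      * intros HX; apply mem_iff in HX; destruct HX as [_ [w [Hw Hc]]].
        apply (HPQ w X Hc), HCQ, Hw.
      * intros HX; destruct (proj1 (element_iff X) (Hel X HX)) as [w Hw].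
        apply (mem_code Hw (Y := inner_object (topology_inner HCT)) (topology_inner HCT)).
        apply HCQ, (HPQ w X Hw), HX.
    + apply TT_iff; exact HCT.
Qed.

Lemma closed_val (X : N) : inner W (val X) -> closed (TT N) X -> closed T (val X).
Proof.
  intros HX [He|[C [[HC HCX] HCT]]].
  - left; intros w Hw; destruct (member_coded HX Hw) as [Y [_ HY]]; exact (He Y HY).
  - apply TT_iff in HCT; pose proof (topology_inner HCT) as HCi.
    apply (closed_iff (P := val C)); [|apply member_closed; [apply HCi|exact HCT]].
    intros w; split; intros Hw.
    + destruct (member_coded HCi Hw) as [Y [HY HYC]].
      apply (mem_code HY HX), HCX, HYC.
    + destruct (member_coded HX Hw) as [Y [HY HYX]].
      apply (mem_code HY HCi), HCX, HYX.
Qed.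

(** [C] is the image of [A] under [Phi]: the class, in [M], of the nonempty sets
    that are elements of [A] in the sense of [N].  Atoms in [A] leave no trace
    in [C]. *)
Definition decodes (A : N) (C : M) : Prop :=
  is_class C /\ forall t, t ∈ C <-> exists w, w ∈ val A /\ app Phi w t.

Lemma decodes_exists (A : N) : exists C, decodes A C.
Proof.
  destruct (comprehension HES (Q := fun t => exists w, w ∈ val A /\ app Phi w t))
    as [C HC].
  - intros t [w [_ H]]; exact (proj2 (app_elements H)).
  - definable.
  - exists C; exact HC.
Qed.

Lemma decodes_topology (A : N) (C : M) : decodes A C -> sub C T.
Proof.
  intros [_ HC] t Ht; apply HC in Ht; destruct Ht as [w [_ Hw]].
  apply (Phi_value Hw).
Qed.

Lemma decodes_mem (A b : N) (C : M) : inner W (val A) -> decodes A C ->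
  val b ∈ T -> (b ∈ A <-> val b ∈ C).
Proof.
  intros HA [_ HC] Hb; rewrite HC; split.
  - intros HbA; apply mem_iff in HbA; destruct HbA as [_ [w [Hw Hc]]].
    exists w; split; [exact Hw|exact (code_inner Hc (topology_inner Hb))].
  - intros [w [Hw H]]; apply (mem_code (code_of_app H) HA); exact Hw.
Qed.

Lemma bigcap_code (A : N) (C : M) (w : M) (X : N) :
  inner W (val A) -> sub A (TT N) -> decodes A C -> code w X ->
  (bigcap A X <-> bigcap C w).
Proof.
  intros HA HAT HC HX; split.
  - intros [_ H]; split; [exact (element_mem (proj1 HX))|].
    intros t Ht; pose proof (decodes_topology HC Ht) as HtT.
    apply (mem_code HX (Y := inner_object (topology_inner HtT)) (topology_inner HtT)).
    apply H, (decodes_mem HA HC (b := inner_object (topology_inner HtT)) HtT), Ht.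
  - intros [_ H]; split; [apply element_iff; eauto|].
    intros b Hb; pose proof (proj1 (TT_iff b) (HAT b Hb)) as HbT.
    apply (mem_code HX (topology_inner HbT)), H, (decodes_mem HA HC HbT), Hb.
Qed.

(** * Translation of formulas *)

(** A slot filled with a variable stands for what the variable codes; a slot
    filled with a parameter stands for that object of [N], which need not have a
    code. *)
Definition represents (s : nat + N) (e : nat -> M) (X : N) : Prop :=
  match s with inl j => code (e j) X | inr Y => X = Y end.

Lemma translate_mem (s s' : nat + N) : exists P : (nat -> M) -> Prop,
  definable P /\ forall e X Y, represents s e X -> represents s' e Y ->
  (X ∈ Y <-> P e).
Proof.
  destruct s' as [k|Y0].
  (* When the right-hand side is coded, membership goes through the value of [Phi]
     at the code; what is tested of that value depends on the left-hand side. *)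
  - assert (HQ : exists Q : (nat -> M) -> M -> Prop,
      (definable (fun e => Q (fun i => e (S i)) (e 0))) /\
      forall (e : nat -> M) X, represents s e X -> forall Y, inner W (val Y) ->
      (X ∈ Y <-> Q e (val Y))).
    { destruct s as [j|X0].
      - exists (fun e t => e j ∈ t); split; [definable|].
        intros e X HX Y HY; exact (mem_code HX HY).
      - exists (fun e t => exists w, w ∈ t /\ Phi_bar B Phi w (val X0)); split.
        + unfold Phi_bar; definable.
        + intros e X -> Y HY; split.
          * intros H; apply H.
          * intros H; split; assumption. }
    destruct HQ as [Q [HQ HQs]].
    exists (fun e => exists t, app Phi (e k) t /\ Q e t); split.
    + apply definable_ex.
      * intros e t [H _]; exact (proj2 (app_elements H)).
      * apply definable_and; [definable|exact HQ].
    + intros e X Y HX HY; split.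
      * intros H; pose proof (proj1 (proj1 (mem_iff X Y) H)) as HYi.
        exists (val Y); split; [exact (code_inner HY HYi)|].
        apply (HQs e X HX Y HYi), H.
      * intros [t [Ht H]].
        assert (HtT : t ∈ T) by apply (Phi_value Ht).
        assert (E : Y = inner_object (topology_inner HtT)).
        { apply (code_functional HY), code_of_app, Ht. }
        rewrite E; apply (HQs e X HX); [exact (topology_inner HtT)|exact H].
  - destruct s as [j|X0].
    + exists (fun e => inner W (val Y0) /\ e j ∈ val Y0); split; [definable|].
      intros e X Y HX ->; split.
      * intros H; pose proof (proj1 (proj1 (mem_iff X Y0) H)) as HYi.
        split; [exact HYi|apply (mem_code HX HYi), H].
      * intros [HYi H]; apply (mem_code HX HYi), H.
    + exists (fun _ => X0 ∈ Y0); split; [apply definable_const|].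
      intros e X Y -> ->; tauto.
Qed.

Lemma translate_eq (s s' : nat + N) : exists P : (nat -> M) -> Prop,
  definable P /\ forall e X Y, represents s e X -> represents s' e Y ->
  (X = Y <-> P e).
Proof.
  assert (Hone : forall (e : nat -> M) j (X Y : N), code (e j) X ->
    (X = Y <-> Phi_bar B Phi (e j) (val Y))).
  { intros e j X Y HX; split.
    - intros <-; apply HX.
    - intros H; exact (code_functional HX (conj (proj1 HX) H)). }
  destruct s as [j|X0], s' as [k|Y0].
  - exists (fun e => e j = e k); split; [definable|].
    intros e X Y HX HY; split.
    + intros <-; exact (code_injective HX HY).
    + intros E; simpl in HX; rewrite E in HX; exact (code_functional HX HY).
  - exists (fun e => Phi_bar B Phi (e j) (val Y0)); split; [unfold Phi_bar; definable|].
    intros e X Y HX ->; exact (Hone e j X Y0 HX).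
  - exists (fun e => Phi_bar B Phi (e k) (val X0)); split; [unfold Phi_bar; definable|].
    intros e X Y -> HY; rewrite <- (Hone e k Y X0 HY); split; auto.
  - exists (fun _ => X0 = Y0); split; [apply definable_const|].
    intros e X Y -> ->; tauto.
Qed.

(** The translation depends on which free variables are coded, but not on the
    codes; under a quantifier the new variable is coded. *)
Lemma translate (f : formula) : forall s : nat -> nat + N,
  exists P : (nat -> M) -> Prop, definable P /\
  forall e e', (forall i, represents (s i) e (e' i)) -> (satC e' f <-> P e).
Proof.
  assert (Hterm : forall (s : nat -> nat + N) (t : term), exists r,
    forall (e : nat -> M) e', (forall i, represents (s i) e (e' i)) -> represents r e (teval e' t)).
  { intros s [n|]; [exists (s n)|exists (inr (atoms N))]; simpl; auto. }
  induction f as [t u|t u| |g IHg h IHh|g IHg]; intros s.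
  - destruct (Hterm s t) as [r Hr], (Hterm s u) as [r' Hr'].
    destruct (translate_mem r r') as [P [HP H]]; exists P; split; [exact HP|].
    intros e e' He; simpl; apply H; auto.
  - destruct (Hterm s t) as [r Hr], (Hterm s u) as [r' Hr'].
    destruct (translate_eq r r') as [P [HP H]]; exists P; split; [exact HP|].
    intros e e' He; simpl; apply H; auto.
  - exists (fun _ => False); split; [apply definable_const|]; simpl; tauto.
  - destruct (IHg s) as [P [HP H]], (IHh s) as [P' [HP' H']].
    exists (fun e => P e -> P' e); split; [apply definable_imp; assumption|].
    intros e e' He; simpl; rewrite (H e e' He), (H' e e' He); tauto.
  - destruct (IHg (fun i => match i with
      | O => inl 0
      | S i => match s i with inl j => inl (S j) | r => r end
      end)) as [P [HP H]].
    exists (fun e => forall w, w ∈ W -> P (scons w e)); split.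
    + apply definable_all_if; [intros e w; exact (element_mem (X := W))|].
      apply definable_imp; [definable|].
      apply (definable_iff (P := P)); [|exact HP].
      intros e; apply (definable_env HP); intros [|i]; reflexivity.
    + assert (Hx : forall (e : nat -> M) e' w X, (forall i, represents (s i) e (e' i)) -> code w X ->
        (satC (scons X e') g <-> P (scons w e))).
      { intros e e' w X He HX; apply H; intros [|i]; simpl; [exact HX|].
        specialize (He i); destruct (s i); exact He. }
      intros e e' He; simpl; split.
      * intros Hs w Hw; destruct (code_total Hw) as [X HX].
        apply (Hx e e' w X He HX), Hs, element_iff; eauto.
      * intros Hs X HX; apply element_iff in HX; destruct HX as [w Hw].
        apply (Hx e e' w X He Hw), Hs, Hw.
Qed.

Lemma translate_relation (Q : N -> N -> Prop) : definable2 Q ->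
  exists R : M -> M -> Prop, definable2 R /\
  forall u v X Y, code u X -> code v Y -> (Q X Y <-> R u v).
Proof.
  intros [f [s Hf]]; destruct (translate f s) as [P [HP H]].
  exists (fun u v => P (scons u (fun _ => v))); split.
  - apply (definable_iff (P := fun e => P (fun i => e (match i with O => 0 | _ => 1 end)))).
    + intros e; apply (definable_env HP); intros [|i]; reflexivity.
    + apply definable_rename; exact HP.
  - intros u v X Y HX HY.
    rewrite <- (Hf (scons X (fun _ => Y))); apply H.
    intros i; destruct (s i) as [[|j]|Z]; simpl; auto.
Qed.

(** * The axioms hold in the interpretation *)

Lemma discrete_val_small (d : N) : discrete d -> small K (val d).
Proof.
  intros [Hd Hsub]; pose proof (set_in_topology Hd) as HdT.
  pose proof (topology_inner HdT) as Hdi.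
  apply (discrete_small HES Ttop Thaus Tcomp W_two HdT); intros y Hy.
  destruct (comprehension HES (Q := fun z => z ∈ val d /\ z <> y)) as [C [HC HCz]].
  { intros z [Hz _]; exact (element_mem Hz). }
  { definable. }
  assert (HCi : inner W C).
  { split; [exact HC|]; intros z Hz; apply HCz in Hz; exact (proj2 Hdi z (proj1 Hz)). }
  destruct (classic (nonempty C)) as [Hne|Hno].
  - right; exists C; split; [split; assumption|].
    apply (set_in_topology (X := inner_object HCi)), Hsub.
    + apply class_iff; exact HCi.
    + apply (sub_iff (X := inner_object HCi) HCi Hdi).
      intros z Hz; apply HCz in Hz; apply Hz.
    + apply (nonempty_iff (X := inner_object HCi) HCi); exact Hne.
  - left; intros z Hz; apply Hno; exists z; apply HCz, Hz.
Qed.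

(** A surjection of [N] is a relation of [N] between elements, so it is a
    definable relation of [M] between codes; composed with [Phi] it covers [C]
    from the codes of a discrete set. *)
Lemma decodes_small (A : N) (C : M) :
  inner W (val A) -> decodes A C -> small (@discrete N) A -> small K C.
Proof.
  intros HA [HC HCt] [He|[d [F [Hd [HF HFs]]]]].
  - left; intros t Ht; apply HCt in Ht; destruct Ht as [w [Hw _]].
    destruct (member_coded HA Hw) as [Y [_ HY]]; exact (He Y HY).
  - destruct (translate_relation (Q := fun X Y => app F X Y)) as [R [HR HRs]].
    { unfold definable2; definable. }
    apply (small_image HES (D := val d)
      (R := fun u t => exists w, w ∈ val A /\ R u w /\ app Phi w t)).
    + unfold definable2; definable.
    + apply discrete_val_small; exact Hd.
    + exact HC.
    + intros t Ht; apply HCt in Ht; destruct Ht as [w [Hw Hwt]].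
      destruct (member_coded HA Hw) as [Y [HwY HYA]].
      destruct (HFs Y HYA) as [X HXY].
      destruct (function_value HF HXY) as [HXd _].
      apply mem_iff in HXd; destruct HXd as [_ [u [Hu HuX]]].
      exists u; split; [exact Hu|]; exists w; split; [exact Hw|split; [|exact Hwt]].
      apply (HRs u w X Y HuX HwY), HXY.
    + intros u t t' Hu _ _ [w [Hw [Huw Hwt]]] [w' [Hw' [Huw' Hwt']]].
      pose proof (topology_inner (set_in_topology (proj1 Hd))) as Hdi.
      destruct (member_coded Hdi Hu) as [X [HuX HXd]].
      destruct (member_coded HA Hw) as [Y [HwY _]].
      destruct (member_coded HA Hw') as [Y' [HwY' _]].
      apply (HRs u w X Y HuX HwY) in Huw; apply (HRs u w' X Y' HuX HwY') in Huw'.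
      destruct HF as [_ [_ HFf]]; destruct (HFf X HXd) as [Z [_ HZ]].
      assert (E : Y = Y') by (rewrite <- (HZ Y Huw); auto).
      rewrite <- E in HwY'; rewrite <- (code_injective HwY HwY') in Hwt'.
      exact (Phi_functional Hwt Hwt').
Qed.

Theorem interpretation_ES : ES N.
Proof.
  constructor.
  - intros X Y HX HY H; apply class_iff in HX; apply class_iff in HY; apply val_inj.
    apply (es_extensionality HES); [apply HX|apply HY|].
    intros w; split; intros Hw.
    + destruct (member_coded HX Hw) as [Z [HZ HZX]]; apply (mem_code HZ HY), H, HZX.
    + destruct (member_coded HY Hw) as [Z [HZ HZY]]; apply (mem_code HZ HX), H, HZY.
  - intros X Y HX HYX; apply mem_iff in HYX.
    destruct HYX as [Hi _]; apply class_iff in Hi; exact (Hi HX).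
  - destruct W_two as [x [y [Hx [Hy Hne]]]].
    destruct (code_total Hx) as [X HX], (code_total Hy) as [Y HY].
    exists X, Y; split; [apply element_iff; eauto|split; [apply element_iff; eauto|]].
    intros E; rewrite <- E in HY; exact (Hne (code_injective HX HY)).
  - intros f e.
    destruct (translate f (fun i => match i with O => inl 0 | S i => inr (e i) end))
      as [P [HP H]].
    destruct (comprehension HES (Q := fun w => w ∈ W /\ P (fun _ => w))) as [C [HC HCw]].
    { intros w [Hw _]; exact (element_mem Hw). }
    { apply definable_and; [definable|].
      exact (definable_rename (fun _ => 0) HP). }
    assert (HCi : inner W C).
    { split; [exact HC|]; intros w Hw; apply HCw in Hw; apply Hw. }
    assert (Hx : forall w X, code w X -> (satC (scons X e) f <-> P (fun _ => w))).
    { intros w X HX; apply H; intros [|i]; simpl; auto. }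
    exists (inner_object HCi); split; [apply class_iff; exact HCi|].
    intros X; split.
    + intros HX; apply mem_iff in HX; destruct HX as [_ [w [Hw HwX]]].
      split; [apply element_iff; eauto|]; apply (Hx w X HwX), HCw, Hw.
    + intros [Hel Hs]; apply element_iff in Hel; destruct Hel as [w Hw].
      apply (mem_code Hw (Y := inner_object HCi) HCi), HCw.
      split; [apply Hw|apply (Hx w X Hw), Hs].
  - intros A HA HAT [b Hb]; apply class_iff in HA.
    destruct (decodes_exists A) as [C HC].
    pose proof (proj1 (TT_iff b) (HAT b Hb)) as HbT.
    assert (HbC : val b ∈ C) by (apply (decodes_mem HA HC HbT), Hb).
    apply (closed_code (Q := bigcap C)).
    + intros X [Hel _]; exact Hel.
    + intros z [_ Hz]; exact (topology_points Ttop HbT (Hz _ HbC)).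
    + intros w X; exact (bigcap_code HA HAT HC).
    + apply (top_cap (proj1 Ttop)); [apply HC|exact (decodes_topology HC)|].
      exists (val b); exact HbC.
  - intros a b Ha Hb Hca Hcb; apply class_iff in Ha; apply class_iff in Hb.
    apply (closed_code (Q := cup (val a) (val b))).
    + intros X [HX|HX]; exact (element_mem HX).
    + intros z [Hz|Hz]; [exact (proj2 Ha z Hz)|exact (proj2 Hb z Hz)].
    + intros w X HX; unfold cup, ext.
      rewrite (mem_code HX Ha), (mem_code HX Hb); tauto.
    + apply (top_cup (proj1 Ttop)); [apply Ha|apply Hb| |]; apply closed_val; assumption.
  - intros a Ha; destruct (proj1 (element_iff a) Ha) as [w Hw].
    apply (closed_code (Q := sing w)).
    + intros X ->; exact Ha.
    + intros z ->; apply Hw.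
    + intros v X HX; unfold sing; split.
      * intros E; rewrite E in HX; exact (code_injective HX Hw).
      * intros E; rewrite E in HX; exact (code_functional HX Hw).
    + right; exact (point_in_topology HES Ttop Thaus (proj1 Hw)).
  - intros a b Ha Hb.
    pose proof (set_in_topology Ha) as HaT; pose proof (set_in_topology Hb) as HbT.
    pose proof (topology_inner HaT) as Hai; pose proof (topology_inner HbT) as Hbi.
    apply (closed_code (Q := fun x => minus W B x /\
      exists t, app Phi x t /\ sub t (val a) /\ nonempty (cap t (val b)))).
    + intros X [[[Hel _] _] _]; exact Hel.
    + intros x [[Hx _] _]; exact Hx.
    + intros w X HX; split.
      * intros [[HXT HXa] [_ [Y [HYX HYb]]]]; apply TT_iff in HXT.
        pose proof (topology_inner HXT) as HXi.
        pose proof (code_inner HX HXi) as HwX.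
        split; [split; apply (Phi_value HwX)|].
        exists (val X); split; [exact HwX|split; [apply (sub_iff HXi Hai), HXa|]].
        apply mem_iff in HYX; destruct HYX as [_ [v [Hv HvY]]].
        exists v; split; [exact Hv|apply (mem_code HvY Hbi), HYb].
      * intros [_ [t [Hwt [Hta [v [Hvt Hvb]]]]]].
        assert (HtT : t ∈ T) by apply (Phi_value Hwt).
        assert (E : X = inner_object (topology_inner HtT)).
        { apply (code_functional HX), code_of_app, Hwt. }
        assert (HXT : val X ∈ T) by (rewrite E; exact HtT).
        assert (Et : val X = t) by (rewrite E; reflexivity).
        pose proof (topology_inner HXT) as HXi; subst t.
        destruct (member_coded HXi Hvt) as [Y [HvY HYX]].
        split; split; try (apply TT_iff; exact HXT).
        -- apply (sub_iff HXi Hai), Hta.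
        -- exists Y; split; [exact HYX|apply (mem_code HvY Hbi), Hvb].
    + exact (box_closed HaT HbT).
  - intros A HA Hsm; apply class_iff in HA.
    destruct (decodes_exists A) as [C HC].
    apply (closed_code (Q := bigcup C)).
    + intros X [b [_ HX]]; exact (element_mem HX).
    + intros z [t [Ht Hz]]; exact (topology_points Ttop (decodes_topology HC Ht) Hz).
    + intros w X HX; split.
      * intros [b [HbA HXb]].
        pose proof (proj1 (proj1 (mem_iff X b) HXb)) as Hbi.
        assert (HbT : val b ∈ T).
        { apply set_in_topology; split; [apply class_iff, Hbi|exact (element_mem HbA)]. }
        exists (val b); split; [apply (decodes_mem HA HC HbT), HbA|].
        apply (mem_code HX Hbi), HXb.
      * intros [t [Ht Hwt]]; pose proof (decodes_topology HC Ht) as HtT.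
        exists (inner_object (topology_inner HtT)); split.
        -- apply (decodes_mem HA HC (b := inner_object (topology_inner HtT)) HtT), Ht.
        -- apply (mem_code HX (Y := inner_object (topology_inner HtT)) (topology_inner HtT)), Hwt.
    + apply (proj2 Ttop); [apply HC|exact (decodes_topology HC)|].
      exact (decodes_small HA HC Hsm).
Qed.

(** * The universe is a set, and sets are compact Hausdorff *)

Theorem interpretation_universe : universe_in_universe N.
Proof.
  exists (inner_object whole_inner); split; [split|].
  - apply class_iff; exact whole_inner.
  - intros X; split.
    + intros HX; split; [exact (element_mem HX)|reflexivity].
    + intros [Hel _]; apply element_iff in Hel; destruct Hel as [w Hw].
      apply (mem_code Hw (Y := inner_object whole_inner) whole_inner), Hw.
  - destruct W_two as [x [_ [Hx _]]].
    destruct (Phi_onto (whole_in_topology HES Ttop Hx)) as [w Hw].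
    apply (mem_code (w := w) (X := inner_object whole_inner) (Y := inner_object whole_inner)).
    + apply code_of_app; exact Hw.
    + exact whole_inner.
    + apply (Phi_value Hw).
Qed.

(** All subclasses of a [K]-small class of points are [K]-small and hence closed,
    so [A] itself is, in [N], a discrete set or empty. *)
Lemma small_discrete (A : N) : inner W (val A) -> small K (val A) ->
  small (@discrete N) A.
Proof.
  intros HA Hsm.
  destruct (classic (nonempty (val A))) as [Hne|Hno].
  - assert (Hset : forall X : N, inner W (val X) -> sub (val X) (val A) ->
      nonempty (val X) -> is_set X).
    { intros X HX HXA HXne; apply topology_set.
      apply (closed_member HES (V := T)); [apply HX| |exact HXne].
      apply (small_closed HES Ttop Thaus); [apply HX|apply HX|].
      exact (small_subclass HES Hsm (proj1 HX) HXA). }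
    apply (small_member interpretation_ES); [|apply class_iff; exact HA].
    split; [apply Hset; [exact HA|intros z Hz; exact Hz|exact Hne]|].
    intros X HX HXA HXne; apply class_iff in HX.
    apply Hset; [exact HX|apply (sub_iff HX HA), HXA|apply (nonempty_iff HX), HXne].
  - left; intros X HX; apply Hno, (nonempty_iff HA); exists X; exact HX.
Qed.

Lemma set_compact (a : N) : is_set a -> kcompact (@discrete N) (box a).
Proof.
  intros Ha A HA HAa HAe; apply class_iff in HA.
  assert (HAT : sub A (TT N)) by (intros b Hb; exact (proj1 (HAa b Hb))).
  destruct (decodes_exists A) as [C HC].
  destruct (Tcomp (B := C)) as [D [HD [HDC [HDs HDe]]]].
  - apply HC.
  - exact (decodes_topology HC).
  - intros z Hz.
    (* When [C] is empty, its intersection is the whole universe of [M]; the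
       intersection of the empty [A] is then nonempty as well, as [W] has points. *)
    assert (HzW : z ∈ W).
    { destruct (classic (exists t, t ∈ C)) as [[t Ht]|Hno].
      - exact (topology_points Ttop (decodes_topology HC Ht) (proj2 Hz t Ht)).
      - destruct W_two as [x [_ [Hx _]]]; destruct (code_total Hx) as [X HX].
        destruct (HAe X); apply (bigcap_code HA HAT HC HX).
        split; [exact (element_mem Hx)|]; intros t Ht; destruct Hno; eauto. }
    destruct (code_total HzW) as [Z HZ].
    apply (HAe Z), (bigcap_code HA HAT HC HZ), Hz.
  - destruct (comprehension HES
      (Q := fun w => w ∈ val A /\ exists t, t ∈ D /\ app Phi w t)) as [E [HE HEw]].
    { intros w [Hw _]; exact (element_mem Hw). }
    { definable. }
    assert (HEi : inner W E).
    { split; [exact HE|]; intros w Hw; apply HEw in Hw; exact (proj2 HA w (proj1 Hw)). }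
    assert (HEA : sub (inner_object HEi) A).
    { apply (sub_iff (X := inner_object HEi) HEi HA).
      intros w Hw; apply HEw in Hw; apply Hw. }
    assert (HED : decodes (inner_object HEi) D).
    { split; [exact HD|]; intros t; split.
      - intros Ht; destruct (proj1 (proj2 HC t) (HDC t Ht)) as [w [Hw Hwt]].
        exists w; split; [|exact Hwt]; apply HEw; split; [exact Hw|]; eauto.
      - intros [w [Hw Hwt]]; apply HEw in Hw; destruct Hw as [_ [t' [Ht' Hwt']]].
        rewrite (Phi_functional Hwt Hwt'); exact Ht'. }
    exists (inner_object HEi); split; [apply class_iff; exact HEi|].
    split; [exact HEA|split].
    + apply small_discrete; [exact HEi|].
      apply (small_image HES (D := D) (R := fun t w => app Phi w t)); auto.
      * unfold definable2; definable.
      * intros w Hw; apply HEw in Hw; apply Hw.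
      * intros t w w' _ _ _ Hw Hw'; exact (Phi_injective Hw Hw').
    + intros X HX; destruct (proj1 (element_iff X) (proj1 HX)) as [w Hw].
      apply (HDe w).
      apply (bigcap_code (A := inner_object HEi) HEi (fun b Hb => HAT b (HEA b Hb)) HED Hw).
      exact HX.
Qed.

(** Open classes of [W] leave open traces on the sets of [N], as the complement of
    the trace is the intersection of two closed sets. *)
Lemma trace_open (a : N) (O : M) : val a ∈ T -> is_open W T O ->
  exists G : N, is_open a (box a) G /\
    forall w X, code w X -> (X ∈ G <-> w ∈ val a /\ w ∈ O).
Proof.
  intros HaT [HO [HOW HOc]]; pose proof (topology_inner HaT) as Hai.
  destruct (comprehension HES (Q := fun w => w ∈ val a /\ w ∈ O)) as [G [HG HGw]].
  { intros w [Hw _]; exact (element_mem Hw). }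
  { definable. }
  assert (HGi : inner W G).
  { split; [exact HG|]; intros w Hw; apply HGw in Hw; exact (HOW w (proj2 Hw)). }
  assert (Hmem : forall w X, code w X ->
    (X ∈ inner_object HGi <-> w ∈ val a /\ w ∈ O)).
  { intros w X HX; rewrite (mem_code HX (Y := inner_object HGi) HGi); apply HGw. }
  exists (inner_object HGi); split; [split; [|split]|exact Hmem].
  - apply class_iff; exact HGi.
  - apply (sub_iff (X := inner_object HGi) HGi Hai).
    intros w Hw; apply HGw in Hw; apply Hw.
  - destruct (comprehension HES (Q := fun w => w ∈ W /\ w ∉ O)) as [C [HC HCw]].
    { intros w [Hw _]; exact (element_mem Hw). }
    { definable. }
    assert (Hcl : closed (TT N) (minus a (inner_object HGi))).
    { apply (closed_code (Q := cap (val a) C)).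
      - intros X [HX _]; exact (element_mem HX).
      - intros w [Hw _]; exact (proj2 Hai w Hw).
      - intros w X HX; unfold minus, cap, ext.
        rewrite (Hmem w X HX), (mem_code HX Hai), HCw.
        split; [|tauto]; intros [Hwa Hn]; split; [exact Hwa|split; [apply HX|tauto]].
      - apply (closed_cap HES Ttop); [apply Hai|exact HC| |].
        + apply member_closed; [apply Hai|exact HaT].
        + apply (closed_iff (P := minus W O)); [|exact HOc].
          intros w; symmetry; apply HCw. }
    destruct Hcl as [He|[D [[HD HDX] HDT]]]; [left; exact He|].
    right; exists D; split; [split; assumption|split; [exact HDT|]].
    intros X HX; apply (HDX X), HX.
Qed.

Lemma set_hausdorff (a : N) : is_set a -> hausdorff a (box a).
Proof.
  intros Ha X Y HX HY Hne; pose proof (set_in_topology Ha) as HaT.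
  apply mem_iff in HX; destruct HX as [Hai [u [Hu HuX]]].
  apply mem_iff in HY; destruct HY as [_ [v [Hv HvY]]].
  destruct (Thaus (x := u) (y := v)) as [O [O' [HO [HO' [HuO [HvO' Hd]]]]]].
  - apply HuX.
  - apply HvY.
  - intros E; rewrite E in HuX; exact (Hne (code_functional HuX HvY)).
  - destruct (trace_open HaT HO) as [G [HG HGw]], (trace_open HaT HO') as [G' [HG' HGw']].
    exists G, G'; split; [exact HG|split; [exact HG'|split; [|split]]].
    + apply (HGw u X HuX); auto.
    + apply (HGw' v Y HvY); auto.
    + intros Z [HZ HZ'].
      destruct (proj1 (element_iff Z) (element_mem HZ)) as [w Hw].
      apply (HGw w Z Hw) in HZ; apply (HGw' w Z Hw) in HZ'.
      exact (Hd w (conj (proj2 HZ) (proj2 HZ'))).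
Qed.

End Interpretation.
Theorem proposition10 (M : structure) (HES : ES M)
  (K W T B Phi S : M)
  (K_class : is_class K) (K_discrete : forall d, d ∈ K -> discrete d)
  (W_class : is_class W) (W_two : exists x y, x ∈ W /\ y ∈ W /\ x <> y)
  (T_class : is_class T) (T_ktopology : ktopology K W T)
  (T_compact : kcompact K T) (T_hausdorff : hausdorff W T)
  (B_open : is_open W T B)
  (B_not_inner : forall x, x ∈ B -> ~ (is_set x /\ sub x W))
  (S_hyperspace : hyperspace K W T S)
  (Phi_homeo : homeomorphism Phi
     (minus W B) (subspace_closed T (minus W B)) T (closed S)) :
  (* 1 *) (exists x y, x ∈ W /\ y ∈ W /\ x <> y) /\
  (* 2 *) ((forall t, t ∈ T <-> image Phi (minus W B) t) /\
           (forall t, t ∈ T -> inner W t) /\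
           (forall x, x ∈ B -> ~ inner W x)) /\
  (* 3 *) (forall x, x ∈ W -> is_in (sing x) T) /\
  (* 4 *) (forall C : M, is_class C -> sub C T -> nonempty C ->
             closed T (bigcap C)) /\
  (* 5 *) (forall x y, x ∈ T -> y ∈ T -> is_in (cup x y) T) /\
  (* 6 *) (forall x, x ∈ T ->
             (forall y, y ∈ x -> is_in (minus x (sing y)) T) -> small K x) /\
  (* 7 *) (forall C : M, is_class C -> sub C T -> nonempty C -> small K C ->
             is_in (bigcup C) T) /\
  (* 8 *) (forall a b, a ∈ T -> b ∈ T ->
             closed T (fun x => minus W B x /\
               exists t, app Phi x t /\ sub t a /\ nonempty (cap t b))) /\
  (* the interpretation *)
  (exists HB : I_dom W B B,
     ES (interpretation Phi HB) /\
     universe_in_universe (interpretation Phi HB) /\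
     every_set_compact_hausdorff (interpretation Phi HB)).
Proof.
  assert (B_class : is_class B) by apply B_open.
  assert (B_sub : sub B W) by apply B_open.
  assert (B_proper : forall x, x ∈ B -> ~ inner W x).
  { intros x Hx [Hc Hsub]; apply (B_not_inner x Hx).
    split; [split; [exact Hc|exact (element_mem Hx)]|exact Hsub]. }
  pose proof (@homeo_value M W T B Phi S Phi_homeo) as Hvalue.
  pose proof (@homeo_total M W T B Phi S Phi_homeo) as Htotal.
  pose proof (@homeo_functional M W T B Phi S Phi_homeo) as Hfunctional.
  pose proof (@homeo_injective M W T B Phi S Phi_homeo) as Hinjective.
  pose proof (@homeo_onto M W T B Phi S Phi_homeo) as Honto.
  pose proof (@coded_box_closed M HES K W T B Phi S T_ktopology B_open S_hyperspace
    Phi_homeo) as Hbox.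
  split; [exact W_two|].
  split.
  { split; [|split; [|exact B_proper]].
    - intros t; split.
      + intros Ht; destruct (Honto t Ht) as [x Hx].
        destruct (Hvalue x t Hx) as [HxW [HxB _]].
        exists x; split; [split|]; assumption.
      + intros [x [_ Hx]]; apply (Hvalue x t Hx).
    - intros t Ht; exact (topology_inner HES T_ktopology Ht). }
  split; [intros x Hx; exact (point_in_topology HES T_ktopology T_hausdorff Hx)|].
  split; [exact (top_cap (proj1 T_ktopology))|].
  split.
  { intros x y Hx Hy.
    pose proof (topology_class HES T_ktopology Hx) as Hxc.
    pose proof (topology_class HES T_ktopology Hy) as Hyc.
    apply closed_is_in.
    - apply (top_cup (proj1 T_ktopology)); [assumption..| |]; apply member_closed; assumption.
    - destruct (topology_nonempty T_ktopology Hx) as [z Hz]; exists z; left; exact Hz. }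
  split.
  { intros x Hx Hiso.
    apply (discrete_small HES T_ktopology T_hausdorff T_compact W_two Hx).
    intros y Hy; right; exact (Hiso y Hy). }
  split.
  { intros C HC HCT [t Ht] HCs; apply closed_is_in.
    - exact (proj2 T_ktopology C HC HCT HCs).
    - destruct (topology_nonempty T_ktopology (HCT t Ht)) as [z Hz].
      exists z, t; split; assumption. }
  split; [exact Hbox|].
  assert (HB : I_dom W B B) by (left; split; assumption).
  exists HB; split; [|split].
  - apply (interpretation_ES HES HB (K := K) (T := T)); assumption.
  - apply (interpretation_universe HES HB (K := K) (T := T)); assumption.
  - intros a Ha; split.
    + apply (set_compact HES (K := K) (T := T)); assumption.
    + apply (set_hausdorff HES (K := K) (T := T)); assumption.
Qed.
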